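(* Let $\epsilon>0$, $\mu>0$, and let $[\rho,\mathbf m,\mathcal E,\mathbf B]^{\top}$ be a solution on $\mathbb R^d\times[0,\infty)$ of the viscous regularization of the divergence-form MHD system $$\partial_t\rho+\mathrm{div}\,\mathbf m=\epsilon\Delta\rho,$$ $$\partial_t\mathbf m+\mathrm{div}\Big(\rho^{-1}\mathbf m\mathbf m^{\top}-\mu^{-1}\mathbf B\mathbf B^{\top}+\mathbb I\big(p+\tfrac1{2\mu}|\mathbf B|^2\big)\Big)=\epsilon\Delta\mathbf m,$$ $$\partial_t\mathcal E+\mathrm{div}\Big(\tfrac{\mathbf m}{\rho}\big(\mathcal E+p+\tfrac1{2\mu}|\mathbf B|^2\big)-\mu^{-1}\mathbf B\big(\mathbf B^{\top}\tfrac{\mathbf m}{\rho}\big)\Big)=\epsilon\Delta\big(\mathcal E-\tfrac1{2\mu}|\mathbf B|^2\big),$$ $$\partial_t\mathbf B+\mathrm{div}\big(\rho^{-1}\mathbf B\mathbf m^{\top}-\rho^{-1}\mathbf m\mathbf B^{\top}\big)=\mathbf 0,$$ with divergence-free initial magnetic field. Assume sufficient smoothness, and that the density and the internal energy uniformly converge to constant states outside a compact domain of interest. Then the minimum entropy principle holds: $$\inf_{\mathbf x\in\mathbb R^d}s\big(\rho(\mathbf x,t),e(\mathbf x,t)\big)\ \ge\ \inf_{\mathbf x\in\mathbb R^d}s_0(\mathbf x),$$ where $s(\rho,e)$ is the specific entropy and $s_0$ is the initial specific entropy.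
   Context: Notation: $\rho$ is the density, $\mathbf m$ the momentum, $\mathbf u=\mathbf m/\rho$ the velocity, $\mathbf B$ the magnetic field, $\mathcal E=\tfrac1{2\rho}|\mathbf m|^2+\rho e+\tfrac1{2\mu}|\mathbf B|^2$ the total energy including the magnetic energy, $e$ the specific internal energy, so $e=\rho^{-1}\big(\mathcal E-\tfrac{1}{2\rho}|\mathbf m|^2-\tfrac1{2\mu}|\mathbf B|^2\big)$; $\mathbb I$ is the $d\times d$ identity matrix, and for a matrix field $(\mathrm{div}\,A)_i=\sum_j\partial_{x_j}A_{ij}$. The initial magnetic field satisfies $\mathrm{div}\,\mathbf B_0=0$, hence $\mathrm{div}\,\mathbf B=0$ for all times. Thermodynamics: the specific entropy is a function $s=s(\rho,e):\mathbb R^+\times\mathbb R^+\to\mathbb R$ consistent with Gibbs' relation $\mathrm ds=\tfrac1\theta\,\mathrm de+\tfrac p\theta\,\mathrm dv$, where $v=\rho^{-1}$ is the specific volume and $\theta$ the temperature. Thus $\partial s/\partial e=1/\theta$, $\partial s/\partial\rho=-p/(\theta\rho^2)$, and the pressure is $p=-\rho^2\,\frac{\partial s}{\partial\rho}\big[\frac{\partial s}{\partial e}\big]^{-1}$. It is assumed that $\frac{\partial s}{\partial e}>0$ (positive temperature) and that $-s$ is strictly convex as a function of $(v,e)=(\rho^{-1},e)$, for all $\rho,e>0$. The density and the internal energy take positive values. *)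

(* Defs.v *)
From HB Require Import structures.
From mathcomp Require Import all_boot all_order all_algebra.
From mathcomp Require Import all_classical all_reals all_analysis.
Set Implicit Arguments.
Unset Strict Implicit.
Unset Printing Implicit Defensive.
Import Order.TTheory GRing.Theory Num.Theory.
Import numFieldNormedType.Exports.
Local Open Scope classical_set_scope.
Local Open Scope ring_scope.

(* Points of R^d are row vectors; vector fields are column-vector valued, so   *)
(* that m m^T is m *m m^T. Time-dependent fields take the time first.          *)

Section calculus.
Variable R : realType.

(* Meant for open D: differentiable k times on D, with continuous derivatives  *)
(* of order k.                                                                 *)
Fixpoint Ck (V W : normedModType R) (k : nat) (D : set V) (f : V -> W) : Prop :=
  if k is k'.+1 then
    (forall x, D x -> differentiable f x) /\ (forall v, Ck k' D ('D_v f))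
  else forall x, D x -> {for x, continuous f}.

Definition strictly_convex_on (V : lmodType R) (A : set V) (f : V -> R) : Prop :=
  forall x y : V, A x -> A y -> x != y ->
  forall t : R, 0 < t < 1 ->
    f (t *: x + (1 - t) *: y) < t * f x + (1 - t) * f y.

Variable d : nat.

Definition partial (W : normedModType R) (j : 'I_d) (f : 'rV[R]_d -> W)
  : 'rV[R]_d -> W := 'D_(delta_mx 0 j) f.

Definition lap (W : normedModType R) (f : 'rV[R]_d -> W) (x : 'rV[R]_d) : W :=
  \sum_j partial j (partial j f) x.

Definition vdiv (F : 'rV[R]_d -> 'cV[R]_d) (x : 'rV[R]_d) : R :=
  \sum_j partial j (fun y => F y j 0) x.

Definition mdiv (A : 'rV[R]_d -> 'M[R]_d) (x : 'rV[R]_d) : 'cV[R]_d :=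
  \col_i \sum_j partial j (fun y => A y i j) x.

Definition dt (W : normedModType R) (f : R -> 'rV[R]_d -> W)
  (t : R) (x : 'rV[R]_d) : W := derive1 (fun tau => f tau x) t.

Definition sqnorm (v : 'cV[R]_d) : R := \sum_i v i 0 ^+ 2.

(* The space-time domain R^d x ]0, +oo[ and its closure at t = 0. *)
Definition spacetime_int : set (R * 'rV[R]_d) := [set z | 0 < z.1].
Definition spacetime : set (R * 'rV[R]_d) := [set z | 0 <= z.1].

(* C^2 for positive times and continuous up to the initial time. *)
Definition classical (W : normedModType R) (f : R -> 'rV[R]_d -> W) : Prop :=
  Ck 2 spacetime_int (fun z => f z.1 z.2) /\
  {within spacetime, continuous (fun z => f z.1 z.2)}.

(* The first-order space derivatives exist at t = 0 and are continuous up to   *)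
(* t = 0; no time derivative at t = 0 is involved.                             *)
Definition space_C1_initially (W : normedModType R) (f : R -> 'rV[R]_d -> W)
  : Prop :=
  (forall x, differentiable (f 0) x) /\
  (forall j, {within spacetime, continuous (fun z => partial j (f z.1) z.2)}).

(* f(., t) tends to the constant c outside compact sets, uniformly in t on     *)
(* bounded time intervals.                                                     *)
Definition cvg_to_constant_state (f : R -> 'rV[R]_d -> R) (c : R) : Prop :=
  forall T eta : R, 0 < eta -> exists2 K : set 'rV[R]_d, compact K &
    forall (t : R) (x : 'rV[R]_d), 0 <= t <= T -> ~ K x -> `|f t x - c| < eta.

End calculus.

Section thermodynamics.
Variable R : realType.
Implicit Types (s : R -> R -> R) (rho e : R).

(* A specific entropy s(rho, e) is a total function of which only the values   *)
(* at rho, e > 0 matter.                                                       *)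
Definition ds_drho s rho e : R := derive1 (fun r => s r e) rho.
Definition ds_de s rho e : R := derive1 (s rho) e.

Definition pressure s rho e : R :=
  - rho ^+ 2 * ds_drho s rho e * (ds_de s rho e)^-1.

Definition quadrant : set (R * R) := [set w | 0 < w.1 /\ 0 < w.2].

Record specific_entropy s : Prop := SpecificEntropy {
  entropy_smooth : Ck 2 quadrant (fun w : R * R => s w.1 w.2) ;
  entropy_temperature : forall rho e : R, 0 < rho -> 0 < e -> 0 < ds_de s rho e ;
  (* here w = (v, e) with v the specific volume *)
  entropy_convex :
    strictly_convex_on quadrant (fun w : R * R => - s w.1^-1 w.2)
}.

End thermodynamics.

Section mhd.
Variables (R : realType) (d : nat) (eps mu : R) (s : R -> R -> R).
Variables (rho : R -> 'rV[R]_d -> R) (m : R -> 'rV[R]_d -> 'cV[R]_d)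
          (E : R -> 'rV[R]_d -> R) (B : R -> 'rV[R]_d -> 'cV[R]_d).

Definition magnetic_energy (t : R) (x : 'rV[R]_d) : R :=
  (2 * mu)^-1 * sqnorm (B t x).

Definition velocity (t : R) (x : 'rV[R]_d) : 'cV[R]_d :=
  (rho t x)^-1 *: m t x.

Definition internal_energy (t : R) (x : 'rV[R]_d) : R :=
  (rho t x)^-1 *
  (E t x - (2 * rho t x)^-1 * sqnorm (m t x) - magnetic_energy t x).

Definition pressure_field (t : R) (x : 'rV[R]_d) : R :=
  pressure s (rho t x) (internal_energy t x).

Definition entropy_field (t : R) (x : 'rV[R]_d) : R :=
  s (rho t x) (internal_energy t x).

Definition momentum_flux (t : R) (x : 'rV[R]_d) : 'M[R]_d :=
  (rho t x)^-1 *: (m t x *m (m t x)^T) - mu^-1 *: (B t x *m (B t x)^T)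
  + (pressure_field t x + magnetic_energy t x)%:M.

Definition energy_flux (t : R) (x : 'rV[R]_d) : 'cV[R]_d :=
  (E t x + pressure_field t x + magnetic_energy t x) *: velocity t x
  - mu^-1 *: (B t x *m ((B t x)^T *m velocity t x)).

Definition induction_flux (t : R) (x : 'rV[R]_d) : 'M[R]_d :=
  (rho t x)^-1 *: (B t x *m (m t x)^T) - (rho t x)^-1 *: (m t x *m (B t x)^T).

Record regularized_mhd : Prop := RegularizedMHD {
  mhd_mass : forall (t : R) (x : 'rV[R]_d), 0 < t ->
    dt rho t x + vdiv (m t) x = eps * lap (rho t) x ;
  mhd_momentum : forall (t : R) (x : 'rV[R]_d), 0 < t ->
    dt m t x + mdiv (momentum_flux t) x = eps *: lap (m t) x ;
  mhd_energy : forall (t : R) (x : 'rV[R]_d), 0 < t ->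
    dt E t x + vdiv (energy_flux t) x
    = eps * lap (fun y => E t y - magnetic_energy t y) x ;
  mhd_induction : forall (t : R) (x : 'rV[R]_d), 0 < t ->
    dt B t x + mdiv (induction_flux t) x = 0
}.

End mhd.

(* Main.v *)
Require Import Defs.
From mathcomp Require Import all_boot all_order all_algebra.
From mathcomp Require Import all_classical all_reals all_analysis.
From mathcomp Require Import ring lra.
Set Implicit Arguments.
Unset Strict Implicit.
Unset Printing Implicit Defensive.
Import Order.TTheory GRing.Theory Num.Theory.
Import numFieldNormedType.Exports.
Local Open Scope classical_set_scope.
Local Open Scope ring_scope.

(** Suppose the specific entropy drops below its initial infimum.  Since it
    tends to a constant at infinity, s + delta t attains, for a small delta > 0,
    a minimum at some (t0, x0) with t0 > 0.  Concavity of s in (1/rho, e) bounds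
    s from above by its tangent at (t0, x0), and convexity of |m|^2 / (2 rho)
    bounds the kinetic energy from below by its tangent; after multiplication by
    rho, this yields a function Q that is affine in the conservative variables
    rho, m, E - |B|^2 / (2 mu), vanishes at (t0, x0) and satisfies
    Q >= rho (delta / s_e) (t0 - t) for t <= t0.  Hence at (t0, x0) the space
    gradient of Q vanishes, its Laplacian is nonnegative and d_t Q < 0.  But the
    equations make d_t Q - eps Lap Q a combination of grad Q and div B, thus 0.
    Only first derivatives of the fluxes enter, and second derivatives of s never
    do.  The constraint div B = 0 propagates because the induction flux is
    antisymmetric. *)

(** * Functions of class C^k *)

(** Differentiability at [x] is a little-o expansion, which sees only the values near [x]. The
    expansion of [f] is thus one of [g], and uniqueness identifies its linear part with the
    differential of [g]. *)
Lemma near_eq_differentiable (R : realType) (V W : normedModType R)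
    (f g : V -> W) (x : V) :
  (\near x, f x = g x) -> differentiable f x -> differentiable g x.
Proof.
move=> fg df.
have gE : g \o shift x = cst (g x) + 'd f x +o_ 0 id.
  apply/eqaddoP => _/posnumP[e].
  have /eqaddoP/(_ e%:num (gt0 e)) := diff_locally df.
  have fg0 : \forall y \near (0 : V), f (y + x) = g (y + x).
    by move: fg; rewrite (near_shift 0) /= subr0.
  apply: filter_app; move: fg0; apply: filterS => y /= fgy.
  by rewrite /= !fctE /= fgy (nbhs_singleton fg).
have d := diff_unique (diff_continuous df) gE.
by apply/diff_locallyP; rewrite d; split => //; apply: diff_continuous.
Qed.

Section Ck_closure.
Variables (R : realType) (V : normedModType R) (D : set V).
Hypothesis oD : open D.

Lemma open_near_eq (W : normedModType R) (f g : V -> W) (x : V) :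
  {in D, f =1 g} -> D x -> \near x, f x = g x.
Proof.
move=> fg Dx; have := open_nbhs_nbhs (conj oD Dx); rewrite nbhs_nearE.
by apply: filterS => y Dy; apply: fg; rewrite inE.
Qed.

(** The rules of differentiation give closed forms that are valid on [D] only, and the closure
    properties below replace derivatives by such forms. Since [D] is open, equality on [D] survives
    differentiation. *)
Lemma Ck_ext (W : normedModType R) k (f g : V -> W) :
  {in D, f =1 g} -> Ck k D f -> Ck k D g.
Proof.
elim: k f g => [|k IH] f g fg /= Ckf.
  move=> x Dx; have := Ckf x Dx.
  have fgx : f x = g x by apply: fg; rewrite inE.
  rewrite /prop_for /continuous_at fgx => cf.
  by apply: cvg_trans cf; apply: near_eq_cvg; exact: open_near_eq.
case: Ckf => df Cf; split=> [x Dx|v].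
  exact: near_eq_differentiable (open_near_eq fg Dx) (df x Dx).
apply: IH (Cf v) => x; rewrite inE => Dx.
by apply: near_eq_derive; exact: open_near_eq.
Qed.

Lemma CkS (W : normedModType R) k (f : V -> W) : Ck k.+1 D f -> Ck k D f.
Proof.
elim: k f => [|k IH] f [df Cf].
  by move=> x Dx; exact/differentiable_continuous/df.
by split=> // v; apply: IH; exact: Cf.
Qed.

Lemma Ck_cst (W : normedModType R) k (a : W) : Ck k D (cst a : V -> W).
Proof.
elim: k a => [|k IH] a; first by move=> x _; exact: cst_continuous.
split=> [x _|v]; first exact: differentiable_cst.
apply: Ck_ext (IH 0) => x _.
by rewrite [RHS]derive_cst.
Qed.

Lemma CkD (W : normedModType R) k (f g : V -> W) :
  Ck k D f -> Ck k D g -> Ck k D (f + g).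
Proof.
elim: k f g => [|k IH] f g.
  by move=> cf cg x Dx; apply: continuousD; [exact: cf|exact: cg].
move=> [df Cf] [dg Cg]; split=> [x Dx|v].
  by apply: differentiableD; [exact: df|exact: dg].
apply: Ck_ext (IH _ _ (Cf v) (Cg v)) => x; rewrite inE => Dx.
by rewrite deriveD //; apply: diff_derivable; [exact: df|exact: dg].
Qed.

Lemma CkN (W : normedModType R) k (f : V -> W) : Ck k D f -> Ck k D (- f).
Proof.
elim: k f => [|k IH] f.
  by move=> cf x Dx; apply: continuousN; exact: cf.
move=> [df Cf]; split=> [x Dx|v]; first by apply: differentiableN; exact: df.
apply: Ck_ext (IH _ (Cf v)) => x; rewrite inE => Dx.
by rewrite deriveN //; apply: diff_derivable; exact: df.
Qed.

Lemma Ck_sum (W : normedModType R) k n (f : 'I_n -> V -> W) :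
  (forall i, Ck k D (f i)) -> Ck k D (\sum_i f i).
Proof.
move=> Cf; elim/big_ind: _ => [|g h Cg Ch|i _]; last exact: Cf.
  exact: Ck_cst.
exact: CkD.
Qed.

Lemma CkM k (f g : V -> R) : Ck k D f -> Ck k D g -> Ck k D (f * g).
Proof.
elim: k f g => [|k IH] f g.
  by move=> cf cg x Dx; apply: continuousM; [exact: cf|exact: cg].
move=> Cf1 Cg1; have [df Cf] := Cf1; have [dg Cg] := Cg1; split=> [x Dx|v].
  by apply: differentiableM; [exact: df|exact: dg].
apply: Ck_ext (CkD (IH _ _ (CkS Cf1) (Cg v)) (IH _ _ (CkS Cg1) (Cf v))) => x.
rewrite inE => Dx.
by rewrite deriveM //; apply: diff_derivable; [exact: df|exact: dg].
Qed.

(** The induction closes because the derivative of 1/f is - (1/f) (1/f) D_v f, in which 1/f is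
    already known to be of class C^k. *)
Lemma CkV k (f : V -> R) :
  (forall x, D x -> f x != 0) -> Ck k D f -> Ck k D (fun x => (f x)^-1).
Proof.
move=> f0; elim: k => [|k IH].
  by move=> cf x Dx; apply: continuousV; [exact: f0|exact: cf].
move=> Cf1; have [df Cf] := Cf1; split=> [x Dx|v].
  by apply: differentiableV; [exact: df|exact: f0].
have CV := IH (CkS Cf1).
apply: Ck_ext (CkN (CkM (CkM CV CV) (Cf v))) => x; rewrite inE => Dx.
rewrite deriveV; [|exact: f0|exact/diff_derivable/df].
by rewrite fctE /= scaleNr -exprVn expr2.
Qed.

Lemma Ck_coord p q k (f : V -> 'M[R]_(p, q)) i j :
  Ck k D f -> Ck k D (fun x => f x i j).
Proof.
elim: k f => [|k IH] f.
  move=> cf x Dx.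
  apply: (@continuous_comp _ _ _ f (fun N : 'M[R]_(p, q) => N i j)).
    exact: cf.
  exact: coord_continuous.
move=> [df Cf]; split=> [x Dx|v].
  apply: (@differentiable_comp _ _ _ _ f (fun N : 'M[R]_(p, q) => N i j)).
    exact: df.
  exact: differentiable_coord.
apply: Ck_ext (IH _ (Cf v)) => x; rewrite inE => Dx.
by rewrite derive_mx ?mxE//; apply: diff_derivable; exact: df.
Qed.

End Ck_closure.

(** * Schwarz' theorem and derivative tests *)

Lemma ler_dist_half (R : realFieldType) (e p q o : R) :
  `|p - o| < e / 2 -> `|q - o| < e / 2 -> `|p - q| <= e.
Proof. by rewrite !ltr_norml ler_norml => /andP[? ?] /andP[? ?]; lra. Qed.

Lemma is_derive_line (R : realType) (V W : normedModType R) (f : V -> W)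
    (x v : V) (a : R) :
  derivable f (a *: v + x) v ->
  is_derive a 1 (fun h => f (h *: v + x)) ('D_v f (a *: v + x)).
Proof.
have E : (fun h : R => h^-1 *: (((fun h => f (h *: v + x)) \o shift a) (h *: 1)
            - f (a *: v + x)))
       = (fun h : R => h^-1 *: ((f \o shift (a *: v + x)) (h *: v)
            - f (a *: v + x))).
  by apply/funext => h /=; rewrite [h *: 1]mulr1 scalerDl addrA.
by move=> df; apply: DeriveDef; rewrite /derivable /derive E.
Qed.

Lemma MVT0 (R : realType) (g dg : R -> R) (h : R) : 0 < h ->
  (forall a : R, 0 <= a <= h -> is_derive a 1 g (dg a)) ->
  exists2 a, 0 < a < h & g h - g 0 = h * dg a.
Proof.
move=> h0 gdg; have [||a ah gE] := @MVT _ g dg _ _ h0.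
- by move=> a /[!in_itv]/= /andP[a0 ah]; apply: gdg; rewrite !ltW.
- by apply: derivable_within_continuous => a /[!in_itv]/= /gdg[].
by exists a; [rewrite in_itv/= in ah|rewrite gE subr0 mulrC].
Qed.

Section schwarz.
Variables (R : realType) (V : normedModType R) (D : set V).

(** The mean value theorem is applied twice: in direction [v] to the difference of [f] along two
    opposite sides of the parallelogram, then in direction [w] to ['D_v f]. *)
Lemma second_difference_MVT (f : V -> R) (x v w : V) (h : R) :
  Ck 2 D f -> 0 < h ->
  (forall a b, 0 <= a <= h -> 0 <= b <= h -> D (a *: v + b *: w + x)) ->
  exists a b, [/\ 0 <= a <= h, 0 <= b <= h &
    f (h *: v + h *: w + x) - f (h *: v + x) - f (h *: w + x) + f x
    = h ^+ 2 * 'D_w ('D_v f) (a *: v + b *: w + x)].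
Proof.
move=> [df Cf] h0 Dh; have [ddf _] := Cf v.
have hh : 0 <= h <= h by rewrite lexx ltW.
have h00 : 0 <= (0 : R) <= h by rewrite lexx ltW.
pose phi (a : R) := f (a *: v + (h *: w + x)) - f (a *: v + x).
have dphi (a : R) : 0 <= a <= h -> is_derive a 1 phi
    ('D_v f (a *: v + (h *: w + x)) - 'D_v f (a *: v + x)).
  move=> ah; apply: is_deriveB; apply: is_derive_line; apply: diff_derivable;
    apply: df; first by rewrite addrA; exact: Dh.
  by have := Dh a 0 ah h00; rewrite scale0r addr0.
have [a /andP[a0 ah] phiE] := MVT0
  (dg := fun a => 'D_v f (a *: v + (h *: w + x)) - 'D_v f (a *: v + x)) h0 dphi.
have ah' : 0 <= a <= h by rewrite !ltW.
pose psi (b : R) := 'D_v f (b *: w + (a *: v + x)).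
have dpsi (b : R) : 0 <= b <= h -> is_derive b 1 psi
    ('D_w ('D_v f) (b *: w + (a *: v + x))).
  move=> bh; apply: is_derive_line; apply: diff_derivable; apply: ddf.
  by rewrite addrCA addrA; exact: Dh.
have [b /andP[b0 bh] psiE] := MVT0
  (dg := fun b => 'D_w ('D_v f) (b *: w + (a *: v + x))) h0 dpsi.
exists a, b; split; [by []|by rewrite !ltW|].
have E1 : a *: v + (h *: w + x) = h *: w + (a *: v + x) by rewrite addrCA.
have E2 : b *: w + (a *: v + x) = a *: v + b *: w + x by rewrite addrCA addrA.
have alg (p q o u X Y : R) :
    p - q - (o - u) = h * Y -> Y = h * X -> p - q - o + u = h ^+ 2 * X.
  by move=> + YE; rewrite YE => E; transitivity (h * (h * X)); [rewrite -E|]; ring.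
rewrite /psi scale0r add0r -E1 E2 in psiE.
rewrite /phi scale0r !add0r addrA in phiE.
exact: (alg _ _ _ _ _ _ phiE psiE).
Qed.

(** The second difference is symmetric in [v] and [w], so the two mixed derivatives take a common
    value, though at different points of a small parallelogram. By continuity both are within e/2 of
    that value at [x]. *)
Lemma schwarz (f : V -> R) (x v w : V) :
  open D -> Ck 2 D f -> D x -> 'D_w ('D_v f) x = 'D_v ('D_w f) x.
Proof.
move=> oD C2f Dx; apply/eqP; rewrite -subr_eq0 -normr_le0.
apply/ler_addgt0Pl => e e0; rewrite addr0.
have [df Cf] := C2f.
have cvw : {for x, continuous ('D_w ('D_v f))} by case: (Cf v) => _ /(_ w); apply.
have cwv : {for x, continuous ('D_v ('D_w f))} by case: (Cf w) => _ /(_ v); apply.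
have e20 : 0 < e / 2 by rewrite divr_gt0.
have : \forall y \near x, D y /\
    (`|'D_w ('D_v f) x - 'D_w ('D_v f) y| < e / 2 /\
     `|'D_v ('D_w f) x - 'D_v ('D_w f) y| < e / 2).
  apply: filterI; first exact: open_nbhs_nbhs.
  apply: filterI.
    by move/cvgrPdist_lt : cvw; apply.
  by move/cvgrPdist_lt : cwv; apply.
move=> /nbhs_ballP[r /= r0 br].
(* The parallelogram of side parameter [h] lies in the ball of radius r/2; the summand 1 keeps the
   denominator positive when [v] and [w] vanish. *)
pose h := r / (2 * (`|v| + `|w| + 1)).
have n0 : 0 < `|v| + `|w| + 1 by rewrite ltr_wpDl// addr_ge0.
have h0 : 0 < h by rewrite divr_gt0// mulr_gt0.
have box (a b : R) : 0 <= a <= h -> 0 <= b <= h -> ball x r (a *: v + b *: w + x).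
  move=> /andP[a0 ah] /andP[b0 bh]; rewrite -ball_normE /ball_ /=.
  rewrite opprD addrCA subrr addr0 normrN.
  apply: (le_lt_trans (ler_normD _ _)); rewrite !normrZ !ger0_norm//.
  apply: (@le_lt_trans _ _ (h * (`|v| + `|w| + 1))).
    rewrite mulrDr mulr1 mulrDr -[leLHS]addr0; apply: lerD; last exact: ltW.
    by apply: lerD; apply: ler_wpM2r.
  have -> : h * (`|v| + `|w| + 1) = r / 2.
    by rewrite /h; field; rewrite gt_eqF.
  lra.
have [a [b [ah bh E1]]] := second_difference_MVT C2f h0
  (fun a b ah bh => (br _ (box a b ah bh)).1).
have [|b' [a' [bh' ah' E2]]] := @second_difference_MVT f x w v h C2f h0.
  by move=> b' a' bh' ah'; rewrite [b' *: w + _]addrC; apply: (br _ (box _ _ ah' bh')).1.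
have [_ [l1 _]] := br _ (box _ _ ah bh).
have [_ [_ l2]] := br _ (box _ _ ah' bh').
have EE : 'D_w ('D_v f) (a *: v + b *: w + x)
        = 'D_v ('D_w f) (a' *: v + b' *: w + x).
  have hn : h ^+ 2 != 0 by rewrite expf_neq0// gt_eqF.
  have alg (p q o u X Y : R) : p - q - o + u = h ^+ 2 * X ->
      p - o - q + u = h ^+ 2 * Y -> X = Y.
    by move=> pX pY; apply: (mulfI hn); rewrite -pX -pY; ring.
  rewrite [h *: w + _]addrC [b' *: w + _]addrC in E2.
  exact: (alg _ _ _ _ _ _ E1 E2).
rewrite -EE in l2.
exact: (ler_dist_half l1 l2).
Qed.

End schwarz.

Section derivative_tests.
Variables (R : realType) (V : normedModType R).
Implicit Types (f : V -> R) (x v : V).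

(** As the limit of the quotients exists, a bound for some arbitrarily small increments is enough.
    This covers one-sided bounds as well as increments supplied by the mean value theorem. *)
Lemma derive_ge_frequently f x v (K : R) : derivable f x v ->
  (forall r : R, 0 < r -> exists2 h : R, 0 < `|h| < r &
     K <= h^-1 * (f (h *: v + x) - f x)) ->
  K <= 'D_v f x.
Proof.
move=> df H; rewrite leNgt; apply/negP => ltK.
have /cvgrPdist_lt/(_ (K - 'D_v f x)) : (fun h : R =>
    h^-1 *: ((f \o shift x) (h *: v) - f x)) @ 0^' --> 'D_v f x by exact: df.
rewrite subr_gt0 => /(_ ltK) [r /= r0 br].
have [h /andP[h0 hr] leh] := H _ r0.
have := br h; rewrite /= sub0r normrN => /(_ hr); rewrite -normr_gt0 => /(_ h0).
rewrite -normrN opprB => /(le_lt_trans (ler_norm _)).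
by rewrite ltrD2r ltNge leh.
Qed.

Lemma derive_le_frequently f x v (K : R) : derivable f x v ->
  (forall r : R, 0 < r -> exists2 h : R, 0 < `|h| < r &
     h^-1 * (f (h *: v + x) - f x) <= K) ->
  'D_v f x <= K.
Proof.
move=> df H; rewrite -lerN2 -deriveN//.
apply: derive_ge_frequently => [|r /H[h hr leh]]; first exact: derivableN.
by exists h => //; rewrite /= -opprD mulrN lerN2.
Qed.

Lemma derive_line_min0 f x v : derivable f x v ->
  (forall h : R, f x <= f (h *: v + x)) -> 'D_v f x = 0.
Proof.
move=> df fmin; apply/eqP; rewrite eq_le; apply/andP; split.
  apply: derive_le_frequently => // r r0; exists (- (r / 2)).
    by rewrite normrN gtr0_norm ?divr_gt0//=; lra.
  by rewrite mulr_le0_ge0 ?subr_ge0// invr_le0; lra.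
apply: derive_ge_frequently => // r r0; exists (r / 2).
  by rewrite gtr0_norm ?divr_gt0//=; lra.
by rewrite mulr_ge0 ?subr_ge0// invr_ge0; lra.
Qed.

(** The first derivative vanishes at the minimum, and by the mean value theorem it is nonnegative at
    points arbitrarily close on the positive side. Hence the quotients of ['D_v f] are frequently
    nonnegative, and no continuity of the second derivative is involved. *)
Lemma derive2_line_min_ge0 f x v :
  (forall h : R, derivable f (h *: v + x) v) -> derivable ('D_v f) x v ->
  (forall h : R, f x <= f (h *: v + x)) -> 0 <= 'D_v ('D_v f) x.
Proof.
move=> df ddf fmin.
have df0 : derivable f x v by have := df 0; rewrite scale0r add0r.
apply: derive_ge_frequently => // r r0.
have r20 : 0 < r / 2 by rewrite divr_gt0.
have dline (h : R) : 0 <= h <= r / 2 ->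
    is_derive h 1 (fun h => f (h *: v + x)) ('D_v f (h *: v + x)).
  by move=> _; exact: (is_derive_line (df h)).
have [c /andP[c0 cr] cE] := MVT0 (dg := fun h => 'D_v f (h *: v + x)) r20 dline.
exists c; first by rewrite gtr0_norm// c0/=; lra.
rewrite (derive_line_min0 df0 fmin) subr0.
apply: mulr_ge0; first by rewrite invr_ge0 ltW.
have : 0 <= f ((r / 2) *: v + x) - f (0 *: v + x).
  by rewrite scale0r add0r subr_ge0.
by rewrite cE pmulr_rge0.
Qed.

End derivative_tests.

(** Convexity bounds the difference quotients at 0 with increment in ]0, 1[ by the slope of the
    chord over [0, 1]. *)
Lemma convex_line_gradient (R : realType) (phi : R -> R) (l : R) :
  (forall t, 0 < t < 1 -> phi t <= t * phi 1 + (1 - t) * phi 0) ->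
  is_derive (0 : R) 1 phi l -> l <= phi 1 - phi 0.
Proof.
move=> cvx [dphi <-]; apply: derive_le_frequently => // r r0.
pose h : R := Num.min (r / 2) 2^-1.
have hP : [/\ 0 < h, h < r & h < 1].
  by rewrite /h lt_min !gt_min; split;
    [apply/andP; split; lra|apply/orP; left; lra|apply/orP; right; lra].
case: hP => h0 hr h1; exists h; first by rewrite gtr0_norm// h0.
rewrite [h *: 1]mulr1 addr0 mulrC ler_pdivrMr//.
by have := cvx h; rewrite h0 h1 => /(_ isT); lra.
Qed.

(** A directional derivative depends only on the restriction to a line. This identifies partial and
    one-variable derivatives with directional derivatives on a product space. *)
Lemma eq_derive_line (R : numFieldType) (U V W : normedModType R)
    (f : U -> W) (g : V -> W) (x u : U) (y v : V) :
  (forall h : R, f (h *: u + x) = g (h *: v + y)) -> 'D_u f x = 'D_v g y.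
Proof.
move=> fg; have fgx : f x = g y.
  by have := fg 0; rewrite !scale0r !add0r.
rewrite /derive; set F := (fun h : R => _ : W); set G := (fun h : R => _ : W).
suff -> : F = G by [].
by apply/funext => h; rewrite /F /G /= fg fgx.
Qed.

Lemma is_derive_pair_comp (R : realType) (S : R * R -> R) (f g : R -> R)
    (t a b : R) :
  differentiable S (f t, g t) -> is_derive t 1 f a -> is_derive t 1 g b ->
  is_derive t 1 (fun u => S (f u, g u))
    (a * derive1 (fun r => S (r, g t)) (f t) + b * derive1 (fun r => S (f t, r)) (g t)).
Proof.
move=> dS [df <-] [dg <-].
have df' : differentiable f t := (derivable1_diffP f t).1 df.
have dg' : differentiable g t := (derivable1_diffP g t).1 dg.
have dp : differentiable (fun u => (f u, g u)) t by exact: differentiable_pair.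
have dSp : differentiable (fun u => S (f u, g u)) t.
  exact: (@differentiable_comp _ _ _ _ (fun u => (f u, g u)) S).
apply: DeriveDef; first exact: diff_derivable.
have E1 : derive1 (fun r => S (r, g t)) (f t) = 'D_(1, 0) S (f t, g t).
  rewrite derive1E; apply: eq_derive_line => h.
  by rewrite -[_ + (f t, g t)]/(h *: 1 + f t, h *: 0 + g t) scaler0 add0r.
have E2 : derive1 (fun r => S (f t, r)) (g t) = 'D_(0, 1) S (f t, g t).
  rewrite derive1E; apply: eq_derive_line => h.
  by rewrite -[_ + (f t, g t)]/(h *: 0 + f t, h *: 1 + g t) scaler0 add0r.
rewrite E1 E2 !deriveE//.
rewrite (@diff_comp _ _ _ _ (fun u => (f u, g u)) S)//= diff_pair//=.
have -> : ('d f t 1, 'd g t 1)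
    = 'd f t 1 *: (1, 0) + 'd g t 1 *: (0, 1) :> R * R.
  congr (_, _); rewrite /=.
    by rewrite [_ *: 1]mulr1 scaler0 addr0.
  by rewrite [_ *: 1]mulr1 scaler0 add0r.
by rewrite linearD !linearZ.
Qed.

(** * The system at a critical point of Q *)

(* Values at one point: u is the velocity, d- and the second index j denote the
   derivative in the j-th space direction; dmom, den and dind are those of the
   momentum, energy and induction fluxes. *)
Section flux_algebra.
Variables (F : fieldType) (n : nat) (mu rho E p mag kappa : F) (u B : 'I_n -> F).
Variables (drho dE dp dmag den : 'I_n -> F) (dm du dB dmom dind : 'I_n -> 'I_n -> F).
Hypothesis mu0 : 2 * mu != 0.
Hypothesis magE : mag = (2 * mu)^-1 * \sum_i B i ^+ 2.
Hypothesis dmagE : forall j, dmag j = mu^-1 * \sum_i B i * dB i j.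
Hypothesis dmE : forall i j, dm i j = drho j * u i + rho * du i j.
Hypothesis kappaE : rho * kappa = rho * (\sum_i u i ^+ 2) - p - (E - mag).
Hypothesis crit : forall j,
  dE j - dmag j - \sum_i u i * dm i j + kappa * drho j = 0.
Hypothesis dmomE : forall i j, dmom i j = dm i j * u j + rho * u i * du j j
  - mu^-1 * (dB i j * B j + B i * dB j j) + (dp j + dmag j) *+ (i == j).
Hypothesis denE : forall j, den j
  = (dE j + dp j + dmag j) * u j + (E + p + mag) * du j j
    - mu^-1 * (dB j j * (\sum_i B i * u i)
               + B j * (\sum_i (dB i j * u i + B i * du i j))).
Hypothesis dindE : forall i j,
  dind i j = dB i j * u j + B i * du j j - (du i j * B j + u i * dB j j).

Lemma sum_momentum_diag j :
  \sum_i u i * dmom i j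
  = \sum_i u i * (dm i j * u j + rho * u i * du j j
      - mu^-1 * (dB i j * B j + B i * dB j j)) + u j * (dp j + dmag j).
Proof.
under eq_bigr => i _ do rewrite dmomE mulrDr.
rewrite big_split /=; congr (_ + _).
rewrite (bigD1 j)//= eqxx mulr1n big1 ?addr0// => i /negPf ->.
by rewrite mulr0n mulr0.
Qed.

(** This is the contribution of the [j]-th direction to the fluxes in d_t Q. The terms with factor
    [u j] add up to a multiple of [crit j], those with factor [du j j] cancel by [kappaE], and
    [dp j] cancels between the energy and momentum fluxes. Of the remaining magnetic terms only one
    with [dB j j] survives, which becomes div B after summation. *)
Lemma flux_column (j : 'I_n) :
  kappa * dm j j + den j - mu^-1 * (\sum_i B i * dind i j)
  - \sum_i u i * dmom i j
  = mu^-1 * (\sum_i B i * u i) * dB j j.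
Proof.
have mu1 : mu != 0 by apply: contra_neq mu0 => ->; rewrite mulr0.
have two0 : (2 : F) != 0 by apply: contra_neq mu0 => ->; rewrite mul0r.
set UB := \sum_i B i * u i.
have ind : \sum_i B i * dind i j
    = u j * (\sum_i B i * dB i j) + du j j * (\sum_i B i ^+ 2)
      - B j * (\sum_i B i * du i j) - dB j j * UB.
  rewrite /UB !mulr_sumr -big_split -!sumrB /=; apply: eq_bigr => i _.
  by rewrite dindE; ring.
have mom : \sum_i u i * (dm i j * u j + rho * u i * du j j
      - mu^-1 * (dB i j * B j + B i * dB j j))
    = u j * (\sum_i u i * dm i j) + rho * du j j * (\sum_i u i ^+ 2)
      - mu^-1 * (B j * (\sum_i dB i j * u i) + dB j j * UB).
  rewrite /UB !mulr_sumr -!big_split /= mulr_sumr -!sumrB /=; apply: eq_bigr => i _.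
  by ring.
have cj := crit j; have kE := kappaE.
rewrite sum_momentum_diag denE ind mom big_split /= dmE dmagE magE.
rewrite dmagE in cj; rewrite magE in kE.
set SB := \sum_i B i ^+ 2 in kE *; set U2 := \sum_i u i ^+ 2 in kE *.
set SBB := \sum_i B i * dB i j in cj *; set UM := \sum_i u i * dm i j in cj *.
set S1 := \sum_i dB i j * u i; set S2 := \sum_i B i * du i j.
(* Solving [crit] for [dE j] and [kappaE] for [p] turns both hypotheses into substitutions, after
   which the claim is an identity of rational functions. *)
have -> : dE j = UM + mu^-1 * SBB - kappa * drho j.
  by apply/eqP; rewrite -subr_eq0 -cj; apply/eqP; ring.
have pE : p = rho * U2 - E + (2 * mu)^-1 * SB - rho * kappa by rewrite kE; ring.
by rewrite pE -/UB; field; rewrite mu1 two0.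
Qed.

Lemma flux_balance : \sum_j dB j j = 0 ->
  kappa * (\sum_j dm j j) + \sum_j den j
  - mu^-1 * (\sum_i B i * (\sum_j dind i j))
  - \sum_i u i * (\sum_j dmom i j) = 0.
Proof.
move=> divB.
have swap (f : 'I_n -> F) g :
    \sum_i f i * (\sum_j g i j) = \sum_j \sum_i f i * g i j :> F.
  by rewrite exchange_big /=; apply: eq_bigr => i _; rewrite mulr_sumr.
rewrite !swap !mulr_sumr -!big_split -!sumrB /=.
under eq_bigr => j _ do rewrite flux_column.
by rewrite -mulr_sumr divB mulr0.
Qed.

(* rt, Et, mt, Bt stand for time derivatives, Lr, LG, Lm for Laplacians, the
   second one being that of E - mag. *)
Lemma affine_combination (eps rt Et Lr LG : F) (mt Bt Lm : 'I_n -> F) :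
  \sum_j dB j j = 0 ->
  rt + \sum_j dm j j = eps * Lr ->
  (forall i, mt i + \sum_j dmom i j = eps * Lm i) ->
  Et + \sum_j den j = eps * LG ->
  (forall i, Bt i + \sum_j dind i j = 0) ->
  Et - mu^-1 * (\sum_i B i * Bt i) - \sum_i u i * mt i + kappa * rt
  = eps * (LG - \sum_i u i * Lm i + kappa * Lr).
Proof.
move=> divB mass mom en ind; have bal := flux_balance divB.
have BtE : \sum_i B i * Bt i = - \sum_i B i * (\sum_j dind i j).
  rewrite -sumrN; apply: eq_bigr => i _.
  by rewrite -mulrN -(addrK (\sum_j dind i j) (Bt i)) ind add0r.
have LmE : eps * (\sum_i u i * Lm i)
    = \sum_i u i * mt i + \sum_i u i * (\sum_j dmom i j).
  by rewrite mulr_sumr -big_split /=; apply: eq_bigr => i _; rewrite -mulrDr mom mulrCA.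
rewrite BtE mulrDr mulrBr mulrCA LmE -en -mass.
by move/eqP: bal; rewrite subr_eq0 => /eqP <-; ring.
Qed.

End flux_algebra.

Lemma sum_affine (F : comPzRingType) n (k : F) (u g r : 'I_n -> F)
    (m : 'I_n -> 'I_n -> F) :
  \sum_j (g j - \sum_i u i * m i j + k * r j)
  = \sum_j g j - \sum_i u i * (\sum_j m i j) + k * \sum_j r j.
Proof.
rewrite big_split sumrB /= -mulr_sumr exchange_big /=; congr (_ - _ + _).
by apply: eq_bigr => i _; rewrite mulr_sumr.
Qed.

Lemma is_derive_affine (R : realType) (V W : normedModType R) n (c : W) (k : R)
    (u : 'I_n -> R) (G r : V -> W) (m : 'I_n -> V -> W) (x v : V) :
  derivable G x v -> derivable r x v -> (forall i, derivable (m i) x v) ->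
  is_derive x v (fun y => c + G y - \sum_i u i *: m i y + k *: r y)
    ('D_v G x - \sum_i u i *: 'D_v (m i) x + k *: 'D_v r x).
Proof.
move=> /derivableP dG /derivableP dr dm.
have -> : (fun y => c + G y - \sum_i u i *: m i y + k *: r y)
    = cst c + G - \sum_i (u i *: m i) + k *: r.
  by apply/funext => y; rewrite !fctE /= fct_sumE.
have dum i : is_derive x v (u i *: m i) (u i *: 'D_v (m i) x).
  exact: (is_deriveZ (u i) (derivableP (dm i))).
have dcG := is_deriveD (is_derive_cst c x v) dG.
have := is_deriveD (is_deriveB dcG (is_derive_sum dum)) (is_deriveZ k dr).
by rewrite add0r.
Qed.

Lemma derive2N (R : realType) (V W : normedModType R) (D : set V)
    (f : V -> W) (x v w : V) :
  open D -> Ck 2 D f -> D x -> 'D_w ('D_v (- f)) x = - 'D_w ('D_v f) x.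
Proof.
move=> oD [df Cf] Dx; have [ddf _] := Cf v.
rewrite -deriveN; last exact: diff_derivable (ddf x Dx).
apply: near_eq_derive; apply: (open_near_eq oD) Dx => y; rewrite inE => Dy.
by rewrite deriveN //; apply: diff_derivable; exact: df.
Qed.

(** Near [x] the first derivative is again a combination of the same shape, with constant term 0, so
    the first-order rule applies a second time. *)
Lemma derive2_affine (R : realType) (V W : normedModType R) (D : set V) n
    (c : W) (k : R) (u : 'I_n -> R) (G r : V -> W) (m : 'I_n -> V -> W)
    (x v w : V) :
  open D -> Ck 2 D G -> Ck 2 D r -> (forall i, Ck 2 D (m i)) -> D x ->
  is_derive x w ('D_v (fun y => c + G y - \sum_i u i *: m i y + k *: r y))
    ('D_w ('D_v G) x - \sum_i u i *: 'D_w ('D_v (m i)) x + k *: 'D_w ('D_v r) x).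
Proof.
move=> oD [dG CG] [dr Cr] Cm Dx.
have dm i y : D y -> derivable (m i) y v.
  by move=> Dy; have [+ _] := Cm i => /(_ y Dy) /diff_derivable; apply.
have := @is_derive_affine _ _ _ n 0 k u ('D_v G) ('D_v r)
  (fun i => 'D_v (m i)) x w (diff_derivable (proj1 (CG v) x Dx))
  (diff_derivable (proj1 (Cr v) x Dx))
  (fun i => diff_derivable (proj1 (proj2 (Cm i) v) x Dx)).
apply: near_eq_is_derive; apply: (open_near_eq oD) Dx => y; rewrite inE => Dy.
have [_ ->] := is_derive_affine c k u (diff_derivable (dG y Dy))
  (diff_derivable (dr y Dy)) (fun i => dm i y Dy).
by rewrite add0r.
Qed.

(* The system in scalar form on an open subset of space-time; e0 is the time
   direction, e j the j-th space direction. *)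
Section regularized_flow.
Variables (R : realType) (V : normedModType R) (D : set V) (n : nat).
Variables (mu eps : R) (e0 : V) (e : 'I_n -> V).
Variables (r E p : V -> R) (m b : 'I_n -> V -> R).
Hypotheses (oD : open D) (mu0 : 0 < mu) (eps0 : 0 < eps).
Hypotheses (Cr : Ck 2 D r) (CE : Ck 2 D E).
Hypotheses (Cm : forall i, Ck 2 D (m i)) (Cb : forall i, Ck 2 D (b i)).
Hypotheses (r0 : forall z, D z -> 0 < r z).

Definition vel i z := (r z)^-1 * m i z.
Definition mag z := (2 * mu)^-1 * \sum_i b i z ^+ 2.
Definition momflux i j z :=
  (r z)^-1 * (m i z * m j z) - mu^-1 * (b i z * b j z)
  + (p z + mag z) *+ (i == j).
Definition enflux j z :=
  (E z + p z + mag z) * vel j z - mu^-1 * (b j z * \sum_k b k z * vel k z).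
Definition indflux i j z :=
  (r z)^-1 * (b i z * m j z) - (r z)^-1 * (m i z * b j z).

Hypotheses (dp : forall z, D z -> differentiable p z).
Hypothesis mass : forall z, D z ->
  'D_e0 r z + \sum_j 'D_(e j) (m j) z = eps * \sum_j 'D_(e j) ('D_(e j) r) z.
Hypothesis momentum : forall z, D z -> forall i,
  'D_e0 (m i) z + \sum_j 'D_(e j) (momflux i j) z
  = eps * \sum_j 'D_(e j) ('D_(e j) (m i)) z.
Hypothesis energy : forall z, D z ->
  'D_e0 E z + \sum_j 'D_(e j) (enflux j) z
  = eps * \sum_j 'D_(e j) ('D_(e j) (fun y => E y - mag y)) z.
Hypothesis induction : forall z, D z -> forall i,
  'D_e0 (b i) z + \sum_j 'D_(e j) (indflux i j) z = 0.

Lemma Ck_vel i : Ck 2 D (vel i).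
Proof.
have rn0 z : D z -> r z != 0 by move=> /r0 /lt0r_neq0.
exact: (CkM oD (CkV oD rn0 Cr) (Cm i)).
Qed.

Lemma mag_fct : mag = (2 * mu)^-1 *: \sum_i (b i * b i).
Proof.
by apply/funext => z; rewrite !fctE fct_sumE /mag; congr (_ * _); apply: eq_bigr.
Qed.

Lemma Ck_mag : Ck 2 D mag.
Proof.
rewrite mag_fct.
exact: (CkM oD (Ck_cst oD 2 _) (Ck_sum oD (fun i => CkM oD (Cb i) (Cb i)))).
Qed.

(** The induction flux contains no pressure, so it has the two derivatives that Schwarz' theorem
    requires of it. *)
Lemma Ck_indflux i j : Ck 2 D (indflux i j).
Proof.
have -> : indflux i j = b i * vel j - vel i * b j.
  by apply/funext => z; rewrite /indflux /vel !fctE; ring.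
exact: (CkD oD (CkM oD (Cb i) (Ck_vel j)) (CkN oD (CkM oD (Ck_vel i) (Cb j)))).
Qed.

Lemma div_constraint z : D z -> 'D_e0 (fun y => \sum_j 'D_(e j) (b j) y) z = 0.
Proof.
move=> Dz.
have -> : (fun y => \sum_j 'D_(e j) (b j) y) = \sum_j 'D_(e j) (b j).
  by apply/funext => y; rewrite fct_sumE.
rewrite derive_sum; last first.
  by move=> j; apply: diff_derivable; have [_ /(_ (e j)) [+ _]] := Cb j; apply.
pose S := \sum_j \sum_i 'D_(e j) ('D_(e i) (indflux j i)) z.
have dind i j v w : derivable ('D_v (indflux i j)) z w.
  by apply: diff_derivable; have [_ /(_ v) [+ _]] := Ck_indflux i j; apply.
transitivity (- S).
  rewrite /S -sumrN; apply: eq_bigr => j _.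
  rewrite (schwarz (e j) e0 oD (Cb j) Dz).
  (* The induction equation holds on a neighbourhood of [z], so it may be differentiated in
     space. *)
  have -> : 'D_(e j) ('D_e0 (b j)) z
      = 'D_(e j) (- \sum_i 'D_(e i) (indflux j i)) z.
    apply: near_eq_derive; apply: (open_near_eq oD) => // y; rewrite inE => Dy.
    rewrite !fctE fct_sumE; apply/eqP; rewrite -addr_eq0; apply/eqP.
    exact: induction.
  rewrite deriveN; last by apply: derivable_sum.
  by rewrite derive_sum.
(* Exchanging the indices reverses the sign of the flux, while Schwarz' theorem restores the order
   of the derivatives. *)
have SN : S = - S.
  rewrite {1}/S exchange_big /= /S -sumrN; apply: eq_bigr => i _.
  rewrite -sumrN; apply: eq_bigr => j _.
  have Hs := schwarz (e i) (e j) oD (Ck_indflux i j) Dz.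
  rewrite -Hs.
  have -> : indflux j i = - indflux i j.
    by apply/funext => y; rewrite !fctE /indflux; ring.
  by rewrite (derive2N (e i) (e j) oD (Ck_indflux i j) Dz).
by lra.
Qed.

Lemma Ck2_is_derive (f : V -> R) z v : Ck 2 D f -> D z -> is_derive z v f ('D_v f z).
Proof. by move=> [df _] Dz; exact: derivableP (diff_derivable (df z Dz)). Qed.

Lemma m_vel i z : D z -> m i z = r z * vel i z.
Proof. by move=> Dz; rewrite /vel mulrA mulfV ?mul1r// lt0r_neq0// r0. Qed.

Lemma derive_m i z v : D z ->
  'D_v (m i) z = 'D_v r z * vel i z + r z * 'D_v (vel i) z.
Proof.
move=> Dz.
have -> : 'D_v (m i) z = 'D_v (r * vel i) z.
  apply: near_eq_derive; apply: (open_near_eq oD) Dz => y; rewrite inE => Dy.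
  exact: m_vel.
have [_ ->] := is_deriveM (Ck2_is_derive v Cr Dz) (Ck2_is_derive v (Ck_vel i) Dz).
by rewrite addrC [vel i z *: _]mulrC.
Qed.

Lemma derive_mag z v : D z ->
  'D_v mag z = mu^-1 * \sum_i b i z * 'D_v (b i) z.
Proof.
move=> Dz; rewrite mag_fct.
pose db i := Ck2_is_derive v (Cb i) Dz.
have [_ ->] := is_deriveZ (2 * mu)^-1 (is_derive_sum (fun i => is_deriveM (db i) (db i))).
have -> : \sum_i (b i z *: 'D_v (b i) z + b i z *: 'D_v (b i) z)
    = 2 * \sum_i b i z * 'D_v (b i) z.
  by rewrite mulr_sumr; apply: eq_bigr => i _; rewrite /GRing.scale/=; ring.
rewrite [LHS]mulrA; congr (_ * _).
by field; rewrite lt0r_neq0.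
Qed.

Lemma derive_momflux i j z v : D z ->
  'D_v (momflux i j) z
  = 'D_v (m i) z * vel j z + r z * vel i z * 'D_v (vel j) z
    - mu^-1 * ('D_v (b i) z * b j z + b i z * 'D_v (b j) z)
    + ('D_v p z + 'D_v mag z) *+ (i == j).
Proof.
move=> Dz; have -> : momflux i j
    = m i * vel j - mu^-1 *: (b i * b j) + (i == j)%:R *: (p + mag).
  apply/funext => y; rewrite /momflux -[(p y + _) *+ _]mulr_natl.
  by rewrite !fctE; congr (_ - _ + _); rewrite /vel; ring.
have dpz := derivableP (diff_derivable (v := v) (dp Dz)).
have [_ DE] := is_deriveD (is_deriveB
    (is_deriveM (Ck2_is_derive v (Cm i) Dz) (Ck2_is_derive v (Ck_vel j) Dz))
    (is_deriveZ mu^-1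
      (is_deriveM (Ck2_is_derive v (Cb i) Dz) (Ck2_is_derive v (Cb j) Dz))))
  (is_deriveZ (i == j)%:R (is_deriveD dpz (Ck2_is_derive v Ck_mag Dz))).
apply: (etrans DE).
rewrite -(m_vel i Dz) -[('D_v p z + _) *+ _]mulr_natl; congr (_ - _ + _).
  by rewrite addrC [vel j z *: _]mulrC.
by congr (_ * _); rewrite addrC [b j z *: _]mulrC.
Qed.

Lemma derive_enflux j z v : D z ->
  'D_v (enflux j) z
  = ('D_v E z + 'D_v p z + 'D_v mag z) * vel j z
    + (E z + p z + mag z) * 'D_v (vel j) z
    - mu^-1 * ('D_v (b j) z * (\sum_i b i z * vel i z)
        + b j z * (\sum_i ('D_v (b i) z * vel i z + b i z * 'D_v (vel i) z))).
Proof.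
move=> Dz; have -> : enflux j = (E + p + mag) * vel j
    - mu^-1 *: (b j * \sum_i (b i * vel i)).
  by apply/funext => y; rewrite /enflux !fctE fct_sumE.
have dpz := derivableP (diff_derivable (v := v) (dp Dz)).
have dE := Ck2_is_derive v CE Dz.
have dmag := Ck2_is_derive v Ck_mag Dz.
pose db i := Ck2_is_derive v (Cb i) Dz.
pose dvel i := Ck2_is_derive v (Ck_vel i) Dz.
have [_ DE] := is_deriveB (is_deriveM (is_deriveD (is_deriveD dE dpz) dmag) (dvel j))
  (is_deriveZ mu^-1 (is_deriveM (db j)
    (is_derive_sum (fun i => is_deriveM (db i) (dvel i))))).
apply: (etrans DE); congr (_ - _); first by rewrite addrC [vel j z *: _]mulrC.
congr (_ * _); rewrite addrC fct_sumE [_ *: 'D_v (b j) z]mulrC.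
congr (_ + _ * _); apply: eq_bigr => i _.
by rewrite addrC [vel i z *: _]mulrC.
Qed.

Lemma derive_indflux i j z v : D z ->
  'D_v (indflux i j) z
  = 'D_v (b i) z * vel j z + b i z * 'D_v (vel j) z
    - ('D_v (vel i) z * b j z + vel i z * 'D_v (b j) z).
Proof.
move=> Dz; have -> : indflux i j = b i * vel j - vel i * b j.
  by apply/funext => y; rewrite /indflux /vel !fctE; ring.
pose db i := Ck2_is_derive v (Cb i) Dz.
pose dvel i := Ck2_is_derive v (Ck_vel i) Dz.
have [_ DE] := is_deriveB (is_deriveM (db i) (dvel j)) (is_deriveM (dvel i) (db j)).
apply: (etrans DE); congr (_ - _); first by rewrite addrC [vel j z *: _]mulrC.
by rewrite addrC [b j z *: _]mulrC.
Qed.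

(** The minimum in space makes the gradient vanish and the Laplacian nonnegative, and then the
    equations give d_t Q = eps Lap Q >= 0. The linear growth of [Q] backwards in time forces d_t Q
    <= - eta instead. Comparison along the coordinate lines and with earlier times is all that these
    tests use. *)
Lemma no_touching z (c kappa eta rad : R) (Q : V -> R) : D z ->
  (forall (h : R) j, D (h *: e j + z)) ->
  \sum_j 'D_(e j) (b j) z = 0 ->
  r z * kappa = r z * \sum_i vel i z ^+ 2 - p z - (E z - mag z) ->
  Q = (fun y => c + (E y - mag y) - \sum_i vel i z *: m i y + kappa *: r y) ->
  (forall (h : R) j, Q z <= Q (h *: e j + z)) ->
  0 < eta -> 0 < rad ->
  (forall h, 0 < h < rad -> Q z + eta * h <= Q (- h *: e0 + z)) -> False.
Proof.
move=> Dz De divb kE QE Qspace eta0 rad0 Qtime.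
pose G y := E y - mag y.
have CG : Ck 2 D G := CkD oD CE (CkN oD Ck_mag).
have dfun f y v : Ck 2 D f -> D y -> derivable f y v.
  by move=> [df _] Dy; exact: diff_derivable (df y Dy).
have dQ y v (Dy : D y) : is_derive y v Q
    ('D_v G y - \sum_i vel i z *: 'D_v (m i) y + kappa *: 'D_v r y).
  by rewrite QE; exact: (is_derive_affine c kappa (fun i => vel i z) (dfun _ _ _ _ CG Dy)
    (dfun _ _ _ _ Cr Dy) (fun i => dfun _ _ _ _ (Cm i) Dy)).
have ddQ v : is_derive z v ('D_v Q)
    ('D_v ('D_v G) z - \sum_i vel i z *: 'D_v ('D_v (m i)) z
      + kappa *: 'D_v ('D_v r) z).
  by rewrite QE; exact: (derive2_affine c kappa (fun i => vel i z) v v oD CG Cr Cm Dz).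
have dGE v : 'D_v G z = 'D_v E z - 'D_v mag z.
  by have [_ ->] := is_deriveB (Ck2_is_derive v CE Dz) (Ck2_is_derive v Ck_mag Dz).
have dQz v : 'D_v Q z
    = 'D_v E z - 'D_v mag z - \sum_i vel i z * 'D_v (m i) z + kappa * 'D_v r z.
  by have [_ ->] := dQ z v Dz; rewrite dGE.
have crit j : 'D_(e j) E z - 'D_(e j) mag z - \sum_i vel i z * 'D_(e j) (m i) z
    + kappa * 'D_(e j) r z = 0.
  rewrite -dQz; apply: derive_line_min0 => [|h]; last exact: Qspace.
  by case: (dQ z (e j) Dz).
have lapQ : 0 <= \sum_j ('D_(e j) ('D_(e j) G) z
    - \sum_i vel i z * 'D_(e j) ('D_(e j) (m i)) z
    + kappa * 'D_(e j) ('D_(e j) r) z).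
  apply: sumr_ge0 => j _; have [ddQd ddQE] := ddQ (e j); rewrite -[leRHS]ddQE.
  apply: derive2_line_min_ge0 => // h.
  by case: (dQ _ (e j) (De h j)).
have timeQ : 'D_e0 Q z <= - eta.
  apply: derive_le_frequently => [|q q0]; first by case: (dQ z e0 Dz).
  pose h := Num.min rad q / 2.
  have m0 : 0 < Num.min rad q by rewrite lt_min rad0.
  have [mr mq] : Num.min rad q <= rad /\ Num.min rad q <= q.
    by rewrite !ge_min !lexx orbT.
  have h0 : 0 < h by rewrite divr_gt0.
  exists (- h); first by rewrite normrN gtr0_norm// h0 /h; lra.
  have hr : 0 < h < rad by rewrite h0 /h; lra.
  rewrite invrN mulNr lerN2 mulrC ler_pdivlMr//.
  by have := Qtime h hr; lra.
have mu20 : 2 * mu != 0 by rewrite mulf_neq0// lt0r_neq0.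
have comb := affine_combination mu20 (erefl (mag z)) (fun j => derive_mag (e j) Dz)
  (fun i j => derive_m i (e j) Dz) kE crit (fun i j => derive_momflux i j (e j) Dz)
  (fun j => derive_enflux j (e j) Dz) (fun i j => derive_indflux i j (e j) Dz)
  divb (mass Dz) (momentum Dz) (energy Dz) (induction Dz).
have lapE := sum_affine kappa (fun i => vel i z) (fun j => 'D_(e j) ('D_(e j) G) z)
  (fun j => 'D_(e j) ('D_(e j) r) z) (fun i j => 'D_(e j) ('D_(e j) (m i)) z).
(* The magnetic sum in [comb] is the time derivative of [mag], so its left side is ['D_e0 Q z] and
   its right side is [eps] times the Laplacian of [Q]. *)
rewrite -lapE -(derive_mag e0 Dz) -dQz in comb.
move: timeQ; rewrite comb leNgt => /negP; apply.
by apply: lt_le_trans (mulr_ge0 (ltW eps0) lapQ); rewrite oppr_lt0.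
Qed.

End regularized_flow.

(** * Thermodynamics *)

Lemma differentiable_fst (R : realType) (U V : normedModType R) (z : U * V) :
  differentiable (fst : U * V -> U) z.
Proof. by apply: linear_differentiable => w; exact: cvg_fst. Qed.

Lemma is_derive_lin (R : realType) (a b : R) :
  is_derive (0 : R) 1 (fun t => a + t * b) b.
Proof.
have := is_deriveD (is_derive_cst a (0 : R) (1 : R))
  (is_deriveM (is_derive_id (0 : R) (1 : R)) (is_derive_cst b (0 : R) (1 : R))).
by rewrite add0r scaler0 add0r [_%:A]mulr1.
Qed.

Section thermodynamics.
Variables (R : realType) (s : R -> R -> R).
Hypothesis hs : specific_entropy s.

Let S (w : R * R) := s w.1 w.2.

Lemma entropy_differentiable (rho e : R) : 0 < rho -> 0 < e ->
  differentiable S (rho, e).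
Proof. by move=> rho0 e0; have [+ _] := entropy_smooth hs; apply. Qed.

Lemma ds_drhoE (w : R * R) : ds_drho s w.1 w.2 = 'D_(1, 0) S w.
Proof.
rewrite /ds_drho derive1E; apply: eq_derive_line => h.
by rewrite /S -[_ + w]/(h *: 1 + w.1, h *: 0 + w.2) scaler0 add0r.
Qed.

Lemma ds_deE (w : R * R) : ds_de s w.1 w.2 = 'D_(0, 1) S w.
Proof.
rewrite /ds_de derive1E; apply: eq_derive_line => h.
by rewrite /S -[_ + w]/(h *: 0 + w.1, h *: 1 + w.2) scaler0 add0r.
Qed.

(** The flux derivatives require the pressure to be differentiable. It is a quotient of first
    derivatives of a C^2 entropy, and positive temperature keeps the denominator away from 0. *)
Lemma pressure_differentiable (rho e : R) : 0 < rho -> 0 < e ->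
  differentiable (fun w => pressure s w.1 w.2) (rho, e).
Proof.
move=> rho0 e0; have [_ C1] := entropy_smooth hs.
have qre : quadrant (rho, e) by [].
have -> : (fun w => pressure s w.1 w.2)
    = (- (fst * fst)) * 'D_(1, 0) S * (fun w => ('D_(0, 1) S w)^-1).
  by apply/funext => w; rewrite /pressure ds_drhoE ds_deE expr2.
apply: differentiableM; last first.
  apply: differentiableV; first by have [+ _] := C1 (0, 1); apply.
  by rewrite -ds_deE lt0r_neq0// (entropy_temperature hs).
apply: differentiableM; last by have [+ _] := C1 (1, 0); apply.
by apply: differentiableN; apply: differentiableM; exact: differentiable_fst.
Qed.

(** A concave function lies below its tangent. In the variables (1/rho, e) the gradient of the
    entropy is [ds_de] times (p, 1), by Gibbs' relation. *)
Lemma entropy_gradient (rho0 e0 rho e : R) : 0 < rho0 -> 0 < e0 -> 0 < rho -> 0 < e ->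
  s rho e - s rho0 e0
  <= ds_de s rho0 e0 * (pressure s rho0 e0 * (rho^-1 - rho0^-1) + (e - e0)).
Proof.
move=> r0 ee0 r1 e1.
(* The segment is straight in the specific volume, so the density along it is the reciprocal of an
   affine function. *)
pose f t := (rho0^-1 + t * (rho^-1 - rho0^-1))^-1.
pose g t := e0 + t * (e - e0).
have f0 : f 0 = rho0 by rewrite /f mul0r addr0 invrK.
have f1 : f 1 = rho by rewrite /f mul1r subrKC invrK.
have g0 : g 0 = e0 by rewrite /g mul0r addr0.
have g1 : g 1 = e by rewrite /g mul1r subrKC.
have df : is_derive (0 : R) 1 f (- rho0 ^+ 2 * (rho^-1 - rho0^-1)).
  have dl := is_derive_lin rho0^-1 (rho^-1 - rho0^-1).
  have n0 : rho0^-1 + 0 * (rho^-1 - rho0^-1) != 0.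
    by rewrite mul0r addr0 invr_neq0// lt0r_neq0.
  have [dl1 dl2] := dl; apply: DeriveDef; first exact: derivableV.
  by rewrite deriveV// dl2 mul0r addr0 exprVn invrK.
have dg : is_derive (0 : R) 1 g (e - e0) := is_derive_lin e0 (e - e0).
have dS : differentiable S (f 0, g 0) by rewrite f0 g0; exact: entropy_differentiable.
have dphi := is_deriveN (is_derive_pair_comp dS df dg).
have := @convex_line_gradient _ _ _ _ dphi.
rewrite -[(- _) 1]/(- s (f 1) (g 1)) -[(- _) 0]/(- s (f 0) (g 0)) f0 f1 g0 g1.
rewrite -/(ds_drho s rho0 e0) -/(ds_de s rho0 e0).
have T0 := entropy_temperature hs r0 ee0.
have -> : ds_de s rho0 e0 * (pressure s rho0 e0 * (rho^-1 - rho0^-1) + (e - e0))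
    = (- rho0 ^+ 2 * (rho^-1 - rho0^-1)) * ds_drho s rho0 e0
      + (e - e0) * ds_de s rho0 e0.
  by rewrite /pressure; field; rewrite !lt0r_neq0.
(* Strict convexity speaks of distinct points only; when the two states coincide, both sides
   vanish. *)
move=> grad; have [[E1 E2]|ne] := eqVneq (rho^-1, e) (rho0^-1, e0).
  by rewrite E1 E2 (invr_inj E1) !subrr mulr0 !mul0r addr0.
suff cvx t : 0 < t < 1 -> - s (f t) (g t) <= t * - s rho e + (1 - t) * - s rho0 e0.
  by have := grad cvx; lra.
move=> t01; apply: ltW.
have qv (r' e' : R) : 0 < r' -> 0 < e' -> quadrant (r'^-1, e').
  by rewrite /quadrant /= invr_gt0.
have := entropy_convex hs (qv _ _ r1 e1) (qv _ _ r0 ee0) ne t01.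
rewrite /= !invrK; congr (- s _ _ < _).
  by rewrite /f; congr (_^-1); rewrite /GRing.scale /=; ring.
by rewrite /g /GRing.scale /=; ring.
Qed.

End thermodynamics.

(** * From the vector equations to scalar ones *)

Lemma derive2_coord (R : realType) (V : normedModType R) (D : set V) p q
    (f : V -> 'M[R]_(p, q)) i j (x v w : V) :
  open D -> Ck 2 D f -> D x ->
  'D_w ('D_v f) x i j = 'D_w ('D_v (fun y => f y i j)) x.
Proof.
move=> oD [df Cf] Dx; have [ddf _] := Cf v.
rewrite derive_mx ?mxE; last exact: diff_derivable (ddf x Dx).
apply: near_eq_derive; apply: (open_near_eq oD) Dx => y; rewrite inE => Dy.
by rewrite derive_mx ?mxE//; exact: diff_derivable (df y Dy).
Qed.

Section spacetime_derivatives.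
Variables (R : realType) (d : nat).
Local Notation Z := (R * 'rV[R]_d)%type.

(** Time and space derivatives become directional derivatives of a single function on the product
    space, so that Schwarz' theorem and the calculus of C^k functions treat them alike. *)
Definition tdir : Z := (1, 0).
Definition xdir (j : 'I_d) : Z := (0, delta_mx 0 j).
Definition st (W : Type) (f : R -> 'rV[R]_d -> W) (z : Z) : W := f z.1 z.2.

Lemma shift_tdir (h : R) (z : Z) : h *: tdir + z = (h + z.1, z.2).
Proof. by rewrite -[LHS]/(h *: 1 + z.1, h *: 0 + z.2) scaler0 add0r [_ *: 1]mulr1. Qed.

Lemma shift_xdir (h : R) j (z : Z) :
  h *: xdir j + z = (z.1, h *: delta_mx 0 j + z.2).
Proof. by rewrite -[LHS]/(h *: 0 + z.1, h *: delta_mx 0 j + z.2) scaler0 add0r. Qed.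

Lemma dtE (W : normedModType R) (f : R -> 'rV[R]_d -> W) z :
  dt f z.1 z.2 = 'D_tdir (st f) z.
Proof.
rewrite /dt derive1E; apply: eq_derive_line => h.
by rewrite shift_tdir /st /= [_ *: 1]mulr1.
Qed.

Lemma partialE (W : normedModType R) (f : R -> 'rV[R]_d -> W) j z :
  partial j (f z.1) z.2 = 'D_(xdir j) (st f) z.
Proof. by apply: eq_derive_line => h; rewrite shift_xdir. Qed.

Lemma lapE (W : normedModType R) (f : R -> 'rV[R]_d -> W) z :
  lap (f z.1) z.2 = \sum_j 'D_(xdir j) ('D_(xdir j) (st f)) z.
Proof.
apply: eq_bigr => j _; rewrite (partialE (fun t => partial j (f t))).
have -> // : st (fun t => partial j (f t)) = 'D_(xdir j) (st f).
by apply/funext => y; exact: partialE.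
Qed.

Lemma open_spacetime_int : open (@spacetime_int R d).
Proof.
have -> : @spacetime_int R d = fst @^-1` [set x : R | 0 < x] by [].
by apply: open_comp => [? _|]; [exact: cvg_fst|exact: open_gt].
Qed.

Lemma dt_coord (f : R -> 'rV[R]_d -> 'cV[R]_d) i (z : Z) :
  Ck 2 (@spacetime_int R d) (st f) -> 0 < z.1 ->
  dt f z.1 z.2 i 0 = 'D_tdir (st (fun t x => f t x i 0)) z.
Proof.
by move=> [df _] z0; rewrite dtE derive_mx ?mxE//; exact: diff_derivable (df z z0).
Qed.

Lemma lap_coord (f : R -> 'rV[R]_d -> 'cV[R]_d) i (z : Z) :
  Ck 2 (@spacetime_int R d) (st f) -> 0 < z.1 ->
  lap (f z.1) z.2 i 0
  = \sum_j 'D_(xdir j) ('D_(xdir j) (st (fun t x => f t x i 0))) z.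
Proof.
move=> Cf z0; rewrite lapE summxE; apply: eq_bigr => j _.
exact: (derive2_coord i 0 (xdir j) (xdir j) open_spacetime_int Cf z0).
Qed.

Lemma mdiv_coord (A : R -> 'rV[R]_d -> 'M[R]_d) i (z : Z) :
  mdiv (A z.1) z.2 i 0 = \sum_j 'D_(xdir j) (st (fun t x => A t x i j)) z.
Proof.
by rewrite mxE; apply: eq_bigr => j _; rewrite (partialE (fun t x => A t x i j)).
Qed.

Lemma vdivE (F : R -> 'rV[R]_d -> 'cV[R]_d) z :
  vdiv (F z.1) z.2 = \sum_j 'D_(xdir j) (st (fun t x => F t x j 0)) z.
Proof.
by apply: eq_bigr => j _; rewrite (partialE (fun t x => F t x j 0)).
Qed.

End spacetime_derivatives.

(** * Minima of perturbed functions *)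

(** This transfers continuity up to the initial time from the closed space-time domain to a time
    line at a fixed point of space. *)
Lemma cvg_within_comp (T U W : topologicalType) (g : T -> U) (f : U -> W)
    (A : set U) (I : set T) (t : T) (l : W) :
  {for t, continuous g} -> (forall s, I s -> A (g s)) ->
  f @ within A (nbhs (g t)) --> l -> (f \o g) @ within I (nbhs t) --> l.
Proof.
move=> cg IA cf X /cf /= nX; have := cg _ nX.
rewrite -[X in X -> _]/(nbhs t [set s | A (g s) -> X (f (g s))]).
rewrite -[X in _ -> X]/(nbhs t [set s | I s -> X (f (g s))]).
by apply: filterS => s H Is; apply: H; exact: IA.
Qed.

(** The left side is the tangent of |m|^2 / (2 rho) at a state of velocity [u]; it has no constant
    term because that function is homogeneous of degree one. The difference of the two sides is a
    sum of squares. *)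
Lemma tangent_kinetic_energy (R : realFieldType) n (rho : R) (u m : 'I_n -> R) :
  0 < rho ->
  \sum_i u i * m i - (\sum_i u i ^+ 2) / 2 * rho
  <= (2 * rho)^-1 * \sum_i m i ^+ 2.
Proof.
move=> rho0; rewrite -subr_ge0 !mulr_suml mulr_sumr -!sumrB.
apply: sumr_ge0 => i _.
have -> : (2 * rho)^-1 * m i ^+ 2 - (u i * m i - u i ^+ 2 / 2 * rho)
    = (2 * rho)^-1 * (m i - rho * u i) ^+ 2.
  by field; rewrite lt0r_neq0.
by rewrite mulr_ge0 ?sqr_ge0// invr_ge0 mulr_ge0// ltW.
Qed.

Lemma compact_rV_neqT (R : realType) d (K : set 'rV[R]_d) :
  (0 < d)%N -> compact K -> exists x, ~ K x.
Proof.
case: d K => // d K _ /compact_bounded [M [_ KM]].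
exists (const_mx (`|M| + 2)) => /(KM (`|M| + 1)).
have -> : (M < `|M| + 1)%R by rewrite (le_lt_trans (ler_norm _))// ltrDl.
move=> /(_ isT); apply/negP; rewrite -ltNge.
apply: (@lt_le_trans _ _ (`|M| + 2)); first by rewrite ltrD2l; lra.
rewrite [leRHS]/Num.Def.normr/= mx_normrE.
apply: (@le_trans _ _ `|(const_mx (`|M| + 2) : 'rV[R]_d.+1) (ord0, ord0).1 (ord0, ord0).2|).
  by rewrite mxE ler_norm.
exact: (le_bigmax _ (fun i : 'I_1 * 'I_d.+1 => `|(const_mx (`|M| + 2) : 'rV[R]_d.+1) i.1 i.2|)).
Qed.

Section minimum.
Variables (R : realType) (d : nat) (S : R -> 'rV[R]_d -> R) (s_oo : R).
Hypotheses (d0 : (0 < d)%N).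
Hypothesis cS : {within @spacetime R d, continuous (fun z => S z.1 z.2)}.
Hypothesis S_oo : cvg_to_constant_state S s_oo.

(** In positive dimension no compact set is the whole space, so [s_oo] is approximated by initial
    values and inherits their lower bound. *)
Lemma initial_bound_far (a : R) : (forall x, a <= S 0 x) -> a <= s_oo.
Proof.
move=> aS; rewrite leNgt; apply/negP => soo_a.
have [|K cK SK] := S_oo 0 (eta := a - s_oo); first by rewrite subr_gt0.
have [x nKx] := compact_rV_neqT d0 cK.
have := SK 0 x; rewrite lexx => /(_ isT nKx).
by rewrite ltr_norml => /andP[_]; have := aS x; lra.
Qed.

(** The function [W] is minimized over the compact set [0, t1] x K, where [K] is so large that the
    values outside it cannot compete with the one at (t1, x1). *)
Lemma perturbed_minimum (a t1 : R) (x1 : 'rV[R]_d) :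
  (forall x, a <= S 0 x) -> 0 <= t1 -> S t1 x1 < a ->
  exists delta t0 x0, [/\ 0 < delta, 0 < t0 &
    forall t x, 0 <= t <= t0 -> S t0 x0 + delta * (t0 - t) <= S t x].
Proof.
move=> aS t10 S1.
(* The perturbation delta t1 must stay below the gap a - S t1 x1; t1 + 1 is positive even for t1 =
   0. *)
pose delta := (a - S t1 x1) / (2 * (t1 + 1)).
have delta0 : 0 < delta by rewrite divr_gt0 ?subr_gt0// mulr_gt0//; lra.
have dt1 : S t1 x1 + delta * t1 < a.
  have : delta * (2 * (t1 + 1)) = a - S t1 x1.
    by rewrite /delta divfK// lt0r_neq0// mulr_gt0//; lra.
  by nra.
pose W (z : R * 'rV[R]_d) := S z.1 z.2 + delta * z.1.
have soo := initial_bound_far aS.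
have [|K cK SK] := S_oo t1 (eta := s_oo - (S t1 x1 + delta * t1)).
  by rewrite subr_gt0 (lt_le_trans dt1).
have far t x : 0 <= t <= t1 -> ~ K x -> S t1 x1 + delta * t1 < S t x.
  by move=> tt1 nK; have := SK t x tt1 nK; rewrite ltr_norml => /andP[]; lra.
pose A : set (R * 'rV[R]_d) := `[0, t1] `*` K.
have A1 : A (t1, x1).
  (* If [x1] were outside [K], then [far] would make S t1 x1 larger than itself plus a nonnegative
     term. *)
  split; rewrite /= ?in_itv/= ?lexx ?t10//.
  apply: contrapT => /(far t1 x1); rewrite lexx t10 => /(_ isT).
  by have := mulr_ge0 (ltW delta0) t10; lra.
have cA : compact A by exact: compact_setX (@segment_compact _ 0 t1) cK.
have AS : A `<=` @spacetime R d.
  by move=> [t x] [/=]; rewrite in_itv/= => /andP[].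
have cW : {within A, continuous W}.
  apply/subspace_continuousP => z Az.
  apply: cvgD; first exact: ((subspace_continuousP _ _).1 (continuous_subspaceW AS cS)).
  apply: cvg_within_filter; apply: cvgM; [exact: cvg_cst|exact: cvg_fst].
have [[t0 x0] + Wmin] := compact_EVT_min (ex_intro _ _ A1) cA cW.
rewrite inE => -[/= /[!in_itv]/= /andP[t00 t01] Kx0].
have W1 : W (t0, x0) <= S t1 x1 + delta * t1 by apply: (Wmin (t1, x1)); rewrite inE.
have Wglobal t x : 0 <= t <= t1 -> W (t0, x0) <= W (t, x).
  move=> tt1; have [Kx|nKx] := pselect (K x).
    by apply: Wmin; rewrite inE; split => //=; rewrite in_itv.
  apply: (le_trans W1); rewrite /W /=; have := far t x tt1 nKx.
  have : 0 <= delta * t by apply: mulr_ge0; [exact: ltW|case/andP: tt1].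
  by lra.
(* A minimum at time 0 would have value at least [a], while [W] is below [a] at (t1, x1). *)
exists delta, t0, x0; split => // [|t x /andP[t0' tt0]].
  rewrite lt_neqAle t00 andbT; apply/eqP => t0E.
  by move: W1; rewrite /W /= -t0E mulr0 addr0; have := aS x0; lra.
have := Wglobal t x; rewrite t0' (le_trans tt0 t01) => /(_ isT).
by rewrite /W /=; lra.
Qed.

End minimum.

(** * The minimum principle *)

Section minimum_entropy.
Variables (R : realType) (d : nat).
Variables (eps mu : R) (heps : 0 < eps) (hmu : 0 < mu).
Variables (s : R -> R -> R) (hs : specific_entropy s).
Variables (rho : R -> 'rV[R]_d -> R) (m : R -> 'rV[R]_d -> 'cV[R]_d)
  (E : R -> 'rV[R]_d -> R) (B : R -> 'rV[R]_d -> 'cV[R]_d).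
Hypotheses (rho_smooth : classical rho) (m_smooth : classical m)
  (E_smooth : classical E) (B_smooth : classical B).
Hypothesis B_initial : space_C1_initially B.
Local Notation ie := (internal_energy mu rho m E B).
Hypothesis rho_gt0 : forall t x, 0 <= t -> 0 < rho t x.
Hypothesis e_gt0 : forall t x, 0 <= t -> 0 < ie t x.
Hypothesis mhd : regularized_mhd eps mu s rho m E B.
Hypothesis divB0 : forall x, vdiv (B 0) x = 0.

Local Notation Z := (R * 'rV[R]_d)%type.
Local Notation D := (@spacetime_int R d).
Local Notation oD := (@open_spacetime_int R d).

Let M (i : 'I_d) : Z -> R := st (fun t x => m t x i 0).
Let b (i : 'I_d) : Z -> R := st (fun t x => B t x i 0).
Let p : Z -> R := st (pressure_field mu s rho m E B).

Let Crho : Ck 2 D (st rho) := rho_smooth.1.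
Let CE : Ck 2 D (st E) := E_smooth.1.
Let CM i : Ck 2 D (M i) := Ck_coord oD i 0 m_smooth.1.
Let Cb i : Ck 2 D (b i) := Ck_coord oD i 0 B_smooth.1.
Let rho0 (z : Z) : D z -> 0 < st rho z. Proof. by move=> /ltW; exact: rho_gt0. Qed.

Lemma internal_energy_fct : st ie
  = (fun z => (st rho z)^-1) * (st E
      + - ((fun z => (2 * st rho z)^-1) * \sum_i (M i * M i)) + - mag mu b).
Proof.
apply/funext => z; rewrite !fctE fct_sumE /mag /st /internal_energy.
by congr (_ * (_ - _ * _ - _)); apply: eq_bigr.
Qed.

Lemma Ck_internal_energy : Ck 2 D (st ie).
Proof.
rewrite internal_energy_fct.
have n0 z : D z -> st rho z != 0 by move=> /rho0 /lt0r_neq0.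
have n20 z : D z -> 2 * st rho z != 0 by move=> /n0; apply: mulf_neq0.
have C2 : Ck 2 D (fun z => 2 * st rho z) := CkM oD (Ck_cst oD 2 (2 : R)) Crho.
have CMM := Ck_sum oD (fun i => CkM oD (CM i) (CM i)).
exact: (CkM oD (CkV oD n0 Crho) (CkD oD (CkD oD CE
  (CkN oD (CkM oD (CkV oD n20 C2) CMM))) (CkN oD (Ck_mag mu oD Cb)))).
Qed.

Lemma pressure_field_differentiable z : D z -> differentiable p z.
Proof.
move=> Dz.
have dre : differentiable (fun z => (st rho z, st ie z)) z.
  by apply: differentiable_pair; [exact: Crho.1|exact: Ck_internal_energy.1].
apply: (@differentiable_comp _ _ _ _ (fun z => (st rho z, st ie z))
  (fun w => pressure s w.1 w.2)) => //.
by apply: pressure_differentiable => //; [exact: rho0|apply: e_gt0; exact: ltW].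
Qed.

Lemma mass_scalar z : D z ->
  'D_(tdir R d) (st rho) z + \sum_j 'D_(xdir R j) (M j) z
  = eps * \sum_j 'D_(xdir R j) ('D_(xdir R j) (st rho)) z.
Proof. by move=> Dz; rewrite -dtE -lapE -vdivE; exact: (mhd_mass mhd). Qed.

Lemma momentum_scalar z : D z -> forall i,
  'D_(tdir R d) (M i) z
    + \sum_j 'D_(xdir R j) (momflux mu (st rho) p M b i j) z
  = eps * \sum_j 'D_(xdir R j) ('D_(xdir R j) (M i)) z.
Proof.
move=> Dz i; rewrite -(dt_coord i m_smooth.1 Dz) -(lap_coord i m_smooth.1 Dz).
have := congr1 (fun c : 'cV[R]_d => c i 0) (mhd_momentum mhd z.2 Dz).
rewrite mxE mdiv_coord [X in _ = X -> _]mxE => <-; congr (_ + _); apply: eq_bigr => j _.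
have -> // : momflux mu (st rho) p M b i j
  = st (fun t x => momentum_flux mu s rho m E B t x i j).
apply/funext => y; rewrite /momflux /st /momentum_flux !mxE !big_ord1 !mxE.
by [].
Qed.

Lemma energy_scalar z : D z ->
  'D_(tdir R d) (st E) z
    + \sum_j 'D_(xdir R j) (enflux mu (st rho) (st E) p M b j) z
  = eps * \sum_j 'D_(xdir R j) ('D_(xdir R j) (fun y => st E y - mag mu b y)) z.
Proof.
move=> Dz; rewrite -dtE.
rewrite -(lapE (fun t y => E t y - magnetic_energy mu B t y)).
rewrite -(mhd_energy mhd z.2 Dz) vdivE; congr (_ + _); apply: eq_bigr => j _.
have -> // : enflux mu (st rho) (st E) p M b j
  = st (fun t x => energy_flux mu s rho m E B t x j 0).
apply/funext => y; rewrite /enflux /st /energy_flux !mxE !big_ord1 !mxE.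
congr (_ - _ * (_ * _)); apply: eq_bigr => k _.
by rewrite !mxE.
Qed.

Lemma induction_scalar z : D z -> forall i,
  'D_(tdir R d) (b i) z
    + \sum_j 'D_(xdir R j) (indflux (st rho) M b i j) z = 0.
Proof.
move=> Dz i; rewrite -(dt_coord i B_smooth.1 Dz).
have := congr1 (fun c : 'cV[R]_d => c i 0) (mhd_induction mhd z.2 Dz).
rewrite mxE mdiv_coord [X in _ = X -> _]mxE => H.
rewrite -[RHS]H; congr (_ + _); apply: eq_bigr => j _.
have -> // : indflux (st rho) M b i j
  = st (fun t x => induction_flux rho m B t x i j).
by apply/funext => y; rewrite /indflux /st /induction_flux !mxE !big_ord1 !mxE.
Qed.

(** At a fixed point of space, div B has zero time derivative for positive times and is continuous
    down to time 0, where it vanishes. The mean value theorem asks for derivatives in the open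
    interval only. *)
Lemma magnetic_div_free z : D z -> \sum_j 'D_(xdir R j) (b j) z = 0.
Proof.
case: z => t x Dz; have t0 : 0 < t by [].
pose G (z : Z) := \sum_j 'D_(xdir R j) (b j) z.
have dG w : D w -> derivable G w (tdir R d).
  have -> : G = \sum_j 'D_(xdir R j) (b j) by apply/funext => y; rewrite fct_sumE.
  move=> Dw; apply: derivable_sum => j; apply: diff_derivable.
  by have [_ /(_ (xdir R j)) [+ _]] := Cb j; apply.
have dg (a : R) : 0 < a -> is_derive a 1 (fun h => G (h *: tdir R d + (0, x))) 0.
  move=> a0; have Da : D (a *: tdir R d + (0, x)).
    by rewrite shift_tdir /spacetime_int /= addr0.
  have := is_derive_line (dG _ Da).
  by rewrite (div_constraint oD Crho CM Cb rho0 induction_scalar Da).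
have coordB (a : R) : 0 <= a -> G (a, x) = \sum_j partial j (B a) x j 0.
  rewrite le_eqVlt => /predU1P[<-|a0]; apply: eq_bigr => j _.
    apply: etrans (esym (partialE (fun t x => B t x j 0) j (0, x))) _.
    rewrite /partial derive_mx ?mxE//.
    by apply: diff_derivable; exact: (B_initial.1 x).
  rewrite [partial j (B a) x](partialE B j (a, x)) derive_mx ?mxE//.
  by apply: diff_derivable; exact: (B_smooth.1.1 (a, x) a0).
have G0 : G (0, x) = 0 by exact: (etrans (esym (vdivE B (0, x))) (divB0 x)).
pose gl (h : R) := G (h *: tdir R d + (0, x)).
have cG : {within `[0, t], continuous gl}.
  apply/subspace_continuousP => a; rewrite /= in_itv /= => a0t.
  pose line (h : R) : Z := (h, x).
  (* Continuity up to the initial time is known for the space derivatives of the vector field [B];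
     [H] takes coordinates after differentiating and agrees with [G] at nonnegative times. *)
  pose H (z : Z) := \sum_j partial j (B z.1) z.2 j 0.
  have GH (h : R) : 0 <= h -> gl h = H (line h).
    by move=> h0; rewrite /gl shift_tdir addr0; exact: coordB.
  have a0 : 0 <= a by case/andP: a0t.
  have cH : H @ within (@spacetime R d) (nbhs (line a)) --> H (line a).
    apply: cvg_big => [|j _]; first exact: add_continuous.
    have cB := (subspace_continuousP _ _).1 (B_initial.2 j) (line a) a0.
    exact: (cvg_comp _ (fun N : 'cV[R]_d => N j 0) cB (@coord_continuous R d 1 j 0 _)).
  have cline : {for a, continuous line}.
    exact: (cvg_pair cvg_id (cvg_cst x)).
  have lineS (h : R) : `[0, t]%classic h -> spacetime (line h).
    by rewrite /= in_itv /= => /andP[].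
  have cHl := cvg_within_comp cline lineS cH.
  rewrite /from_subspace (GH a a0); apply: cvg_trans cHl; apply: near_eq_cvg.
  rewrite near_withinE; near=> h => /=; rewrite in_itv /= => /andP[h0 _].
  by rewrite GH.
have dg' (a : R) : a \in `]0, t[%R -> is_derive a 1 gl 0.
  by rewrite in_itv /= => /andP[a0 _]; exact: dg.
have [a _] := @MVT _ gl (fun=> 0) 0 t t0 dg' cG.
by rewrite /gl !shift_tdir /= !addr0 G0 subr0 mul0r.
Unshelve. all: by end_near. Qed.

Lemma cvg_st (W : normedModType R) (f : R -> 'rV[R]_d -> W) (z : Z) :
  classical f -> spacetime z -> st f @ within (@spacetime R d) (nbhs z) --> st f z.
Proof. by move=> [_ /subspace_continuousP]; apply. Qed.

Lemma entropy_continuous :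
  {within @spacetime R d, continuous (st (entropy_field mu s rho m E B))}.
Proof.
apply/subspace_continuousP => z Sz; set F := within _ _.
have crho : st rho @ F --> st rho z by exact: cvg_st.
have cE : st E @ F --> st E z by exact: cvg_st.
have cM i : M i @ F --> M i z.
  exact: (cvg_comp _ (fun N : 'cV[R]_d => N i 0) (cvg_st m_smooth Sz)
    (@coord_continuous R d 1 i 0 _)).
have cb i : b i @ F --> b i z.
  exact: (cvg_comp _ (fun N : 'cV[R]_d => N i 0) (cvg_st B_smooth Sz)
    (@coord_continuous R d 1 i 0 _)).
have r0 : st rho z != 0 by rewrite lt0r_neq0// rho_gt0.
have csum (f : 'I_d -> Z -> R) : (forall i, f i @ F --> f i z) ->
    (fun y => \sum_i f i y ^+ 2) @ F --> \sum_i f i z ^+ 2.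
  move=> cf; apply: cvg_big => [|i _]; first exact: add_continuous.
  by rewrite expr2; under eq_fun do rewrite expr2; apply: cvgM.
have cie : st ie @ F --> st ie z.
  apply: cvgM; first exact: cvgV.
  apply: cvgB; last by apply: cvgM; [exact: cvg_cst|exact: csum].
  apply: cvgB => //; apply: cvgM; last exact: csum.
  by apply: cvgV; [rewrite mulf_neq0|apply: cvgM => //; exact: cvg_cst].
have dS := entropy_differentiable hs (rho_gt0 z.2 Sz) (e_gt0 z.2 Sz).
exact: (cvg_comp _ _ (cvg_pair crho cie) (differentiable_continuous dS)).
Qed.

(** The entropy is continuous at the limit state because both limits are positive; the union of the
    two compact sets serves for the pair. *)
Lemma entropy_far (rho_oo e_oo : R) : 0 < rho_oo -> 0 < e_oo ->
  cvg_to_constant_state rho rho_oo -> cvg_to_constant_state ie e_oo ->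
  cvg_to_constant_state (entropy_field mu s rho m E B) (s rho_oo e_oo).
Proof.
move=> rho_oo0 e_oo0 rho_cvg e_cvg T eta eta0.
have /cvgrPdist_lt/(_ _ eta0) := differentiable_continuous
  (entropy_differentiable hs rho_oo0 e_oo0).
move=> [[U V] /= [/nbhs_ballP[q1 /= q10 bU] /nbhs_ballP[q2 /= q20 bV]] UV].
have [K1 cK1 K1P] := rho_cvg T q1 q10; have [K2 cK2 K2P] := e_cvg T q2 q20.
exists (K1 `|` K2); first exact: compactU.
move=> t x tT nK; rewrite distrC; apply: (UV (rho t x, ie t x)); split => /=.
  by apply: bU; rewrite -ball_normE /= distrC; apply: K1P => // ?; apply: nK; left.
by apply: bV; rewrite -ball_normE /= distrC; apply: K2P => // ?; apply: nK; right.
Qed.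

Lemma no_perturbed_minimum (delta t0 : R) (x0 : 'rV[R]_d) :
  0 < delta -> 0 < t0 ->
  (forall t x, 0 <= t <= t0 ->
     entropy_field mu s rho m E B t0 x0 + delta * (t0 - t)
     <= entropy_field mu s rho m E B t x) -> False.
Proof.
move=> delta0 t00 Smin.
pose z0 : Z := (t0, x0); have Dz0 : D z0 by [].
have r0 := rho_gt0 x0 (ltW t00); have e0 := e_gt0 x0 (ltW t00).
set r := rho t0 x0 in r0; set e := ie t0 x0 in e0.
have beta0 := entropy_temperature hs r0 e0; set beta := ds_de s r e in beta0.
pose p0 := pressure s r e.
pose u i := vel (st rho) M i z0.
(* With this coefficient of the density, [Q] is rho (p0 (1/rho - 1/r) + ie - e) plus the gap between
   the kinetic energy and its tangent. The first term is controlled by the entropy tangent, the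
   second is nonnegative. *)
pose kappa := (\sum_i u i ^+ 2) / 2 - e - p0 / r.
pose Q (z : Z) := p0 + (st E z - mag mu b z) - \sum_i u i *: M i z + kappa *: st rho z.
have EE t x : 0 <= t -> st E (t, x) - mag mu b (t, x)
    = rho t x * ie t x + (2 * rho t x)^-1 * \sum_i M i (t, x) ^+ 2.
  move=> /(rho_gt0 x)/lt0r_neq0 n0; rewrite /internal_energy mulrA mulfV// mul1r.
  rewrite -[magnetic_energy _ _ _ _]/(mag mu b (t, x)) -[sqnorm _]/(\sum_i M i (t, x) ^+ 2).
  by rewrite /st /=; ring.
have Mu i : M i z0 = r * u i := m_vel M rho0 i Dz0.
have sumM : \sum_i M i z0 ^+ 2 = r ^+ 2 * \sum_i u i ^+ 2.
  by rewrite mulr_sumr; apply: eq_bigr => i _; rewrite Mu exprMn.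
have sumuM : \sum_i u i *: M i z0 = r * \sum_i u i ^+ 2.
  by rewrite mulr_sumr; apply: eq_bigr => i _; rewrite Mu [LHS]mulrCA expr2.
have rn0 : r != 0 by rewrite lt0r_neq0.
have Q0 : Q z0 = 0.
  rewrite /Q sumuM (EE _ _ (ltW t00)) sumM -/r -/e /kappa.
  by rewrite /GRing.scale /= /st /= -/r; field.
have Qge t x : 0 <= t <= t0 -> rho t x * (delta / beta * (t0 - t)) <= Q (t, x).
  move=> tt0; have tge0 : 0 <= t by case/andP: tt0.
  have rt := rho_gt0 x tge0; have et := e_gt0 x tge0.
  have := entropy_gradient hs r0 e0 rt et; rewrite -/beta -/p0 => gr.
  have gr2 : delta / beta * (t0 - t) <= p0 * ((rho t x)^-1 - r^-1) + (ie t x - e).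
    rewrite mulrAC ler_pdivrMr// mulrC [leRHS]mulrC mulrC.
    by apply: le_trans gr; have := Smin t x tt0; rewrite /entropy_field -/r -/e; lra.
  have kin := @tangent_kinetic_energy _ _ (rho t x) u (fun i => M i (t, x)) rt.
  apply: (le_trans (ler_wpM2l (ltW rt) gr2)).
  rewrite /Q (EE _ _ tge0) /kappa -[st rho (t, x)]/(rho t x).
  rewrite -[_ *: rho t x]/(_ * rho t x).
  rewrite -[\sum_i u i *: _]/(\sum_i u i * M i (t, x)).
  have -> : rho t x * (p0 * ((rho t x)^-1 - r^-1) + (ie t x - e))
      = p0 - p0 / r * rho t x + rho t x * ie t x - rho t x * e.
    by field; rewrite rn0 lt0r_neq0.
  by lra.
(* The lower bound of [Q] carries the variable density as a factor; near [z0] that factor exceeds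
   r/2, which yields a constant rate of growth backwards in time. *)
have crho : \forall y \near z0, r / 2 < st rho y.
  have cr : {for z0, continuous (st rho)} by exact/differentiable_continuous/Crho.1.
  by apply: (cvgr_gt _ cr); rewrite /st /= -/r; lra.
have [q /= q0 bq] := (nbhs_ballP _ _).1 crho.
have eta0 : 0 < r / 2 * (delta / beta) by rewrite !mulr_gt0// ?invr_gt0.
have rad0 : 0 < Num.min q t0 by rewrite lt_min t00 q0.
apply: (@no_touching R _ D d mu eps (tdir R d) (xdir R (d := d)) (st rho) (st E) p M b
  oD hmu heps Crho CE CM Cb rho0 pressure_field_differentiable mass_scalar
  momentum_scalar energy_scalar induction_scalar z0 p0 kappa
  (r / 2 * (delta / beta)) (Num.min q t0) Q Dz0 _ (magnetic_div_free Dz0) _ _ _ eta0 rad0).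
- by move=> h j; rewrite shift_xdir.
- rewrite (EE _ _ (ltW t00)) sumM -/r -/e /kappa -[p z0]/p0 /st /= -/r.
  by field.
- by [].
- move=> h j; rewrite Q0 shift_xdir.
  apply: le_trans (Qge _ _ _); first by rewrite subrr !mulr0.
  by rewrite lexx ltW.
- move=> h /andP[h0]; rewrite lt_min => /andP[hq ht]; rewrite Q0 add0r shift_tdir.
  have ht0 : 0 <= - h + t0 <= t0 by apply/andP; split; lra.
  apply: le_trans (Qge _ _ ht0).
  have -> : t0 - (- h + t0) = h by lra.
  rewrite -mulrA; apply: ler_wpM2r.
    by rewrite mulr_ge0 ?ltW// mulr_gt0// invr_gt0.
  apply: ltW; apply: (bq (- h + t0, x0)).
  split => /=; last exact: ballxx.
  by rewrite -ball_normE /= opprD opprK addrCA subrr addr0 gtr0_norm.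
Qed.

End minimum_entropy.

Theorem lemma2p2 (R : realType) (d : nat) (hd : (0 < d)%N)
  (eps mu : R) (heps : 0 < eps) (hmu : 0 < mu)
  (s : R -> R -> R) (hs : specific_entropy s)
  (rho : R -> 'rV[R]_d -> R) (m : R -> 'rV[R]_d -> 'cV[R]_d)
  (E : R -> 'rV[R]_d -> R) (B : R -> 'rV[R]_d -> 'cV[R]_d)
  (rho_smooth : classical rho) (m_smooth : classical m)
  (E_smooth : classical E) (B_smooth : classical B)
  (B_initial : space_C1_initially B)
  (rho_gt0 : forall (t : R) (x : 'rV[R]_d), 0 <= t -> 0 < rho t x)
  (e_gt0 : forall (t : R) (x : 'rV[R]_d), 0 <= t -> 0 < internal_energy mu rho m E B t x)
  (mhd : regularized_mhd eps mu s rho m E B)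
  (divB0 : forall x : 'rV[R]_d, vdiv (B 0) x = 0)
  (rho_oo e_oo : R) (rho_oo_gt0 : 0 < rho_oo) (e_oo_gt0 : 0 < e_oo)
  (rho_cvg : cvg_to_constant_state rho rho_oo)
  (e_cvg : cvg_to_constant_state (internal_energy mu rho m E B) e_oo)
  (t : R) (ht : 0 <= t) :
  (ereal_inf [set (entropy_field mu s rho m E B 0 x)%:E | x in [set: 'rV[R]_d]]
   <= ereal_inf [set (entropy_field mu s rho m E B t x)%:E
                | x in [set: 'rV[R]_d]])%E.
Proof.
apply: le_ereal_inf_tmp => _ [x1 _ <-].
set S0 := [set _ | _ in _]; rewrite leNgt; apply/negP => ltS.
(* The initial infimum is a priori an extended real. If it is finite it serves as [a]; if it is +oo,
   any real above the entropy at (t, x1) does. *)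
have [a Sa aS0] : exists2 a : R, entropy_field mu s rho m E B t x1 < a
    & (a%:E <= ereal_inf S0)%E.
  case: (ereal_inf S0) ltS => [r||]//= ltS; first by exists r.
  by exists (entropy_field mu s rho m E B t x1 + 1); rewrite ?ltrDl ?leey.
have aS x : a <= entropy_field mu s rho m E B 0 x.
  by rewrite -lee_fin (le_trans aS0)//; apply: ereal_inf_lbound; exists x.
have [delta [t0 [x0 [delta0 t00 Smin]]]] := perturbed_minimum hd
  (entropy_continuous hs rho_smooth m_smooth E_smooth B_smooth rho_gt0 e_gt0)
  (entropy_far hs rho_oo_gt0 e_oo_gt0 rho_cvg e_cvg) aS ht Sa.
exact: (no_perturbed_minimum heps hmu hs rho_smooth m_smooth E_smooth B_smooth
  B_initial rho_gt0 e_gt0 mhd divB0 delta0 t00 Smin).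
Qed.
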